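(* Let $m\in\mathbb{N}$, let $W$ be a non-negative random variable with $\mathbb{P}(W>0)=1$, $\mathbb{E}[W]<\infty$ and distribution $\mu$, and for $k\in\mathbb{N}_0$ let $$p(k)=\int_0^\infty\frac{\mathbb{E}[W]/m}{\mathbb{E}[W]/m+x}\Big(\frac{x}{\mathbb{E}[W]/m+x}\Big)^{k}\mu(\mathrm{d}x).$$ All $o(1)$ terms below are as $k\to\infty$. **(Bounded)** Suppose $x_0:=\sup\{x>0:\mathbb{P}(W\le x)<1\}=1$ and let $\theta_m:=1+\mathbb{E}[W]/m$. (a) If $W$ belongs to the Weibull maximum domain of attraction with parameter $\alpha>1$, meaning that $\mathbb{P}(W\ge 1-1/x)=\ell(x)x^{-(\alpha-1)}$ for some function $\ell$ slowly varying at infinity, then there are functions $\underline L,\overline L$ that are slowly varying at infinity such that for all $k>m/\mathbb{E}[W]$, $$\underline L(k)k^{-(\alpha-1)}\theta_m^{-k}\le p(k)\le\overline L(k)k^{-(\alpha-1)}\theta_m^{-k}.$$ (b) (Gumbel maximum domain of attraction.) (i) If there exist $a,c_1,\tau>0$ and $b\in\mathbb{R}$ such that $\mathbb{P}((1-W)^{-1}\ge x)\sim a x^b\mathrm{e}^{-(x/c_1)^\tau}$ as $x\to\infty$, then with $\gamma:=1/(\tau+1)$, $$p(k)=\exp\Big(-(1+o(1))\frac{\tau^\gamma}{1-\gamma}\Big(\frac{(1-\theta_m^{-1})k}{c_1}\Big)^{1-\gamma}\Big)\theta_m^{-k}.$$ (ii) If there exist $a,c_1>0$, $b\in\mathbb{R}$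 and $\tau>1$ such that $\mathbb{P}((1-W)^{-1}\ge x)\sim a(\log x)^b\mathrm{e}^{-(\log(x)/c_1)^\tau}$ as $x\to\infty$, then $$p(k)=\exp\Big(-\Big(\frac{\log k}{c_1}\Big)^\tau\Big(1-\tau(\tau-1)\frac{\log\log k}{\log k}+\frac{K_{\tau,c_1,\theta_m}+o(1)}{\log k}\Big)\Big)\theta_m^{-k},$$ where $K_{\tau,c_1,\theta_m}:=\tau\log(\mathrm{e}c_1^\tau(1-\theta_m^{-1})/\tau)$. (c) If $W$ has an atom at $x_0=1$, i.e. $q_0:=\mathbb{P}(W=x_0)>0$, then $$p(k)=q_0(1-\theta_m^{-1})\theta_m^{-k}(1+o(1)).$$ **(Gumbel)** Suppose $\mathbb{E}[W]=1$. (i) If there exist $a,c_1,\tau>0$ and $b\in\mathbb{R}$ such that $\mathbb{P}(W\ge x)\sim ax^b\mathrm{e}^{-(x/c_1)^\tau}$ as $x\to\infty$, then with $\gamma:=1/(\tau+1)$, $$p(k)=\exp\Big(-\frac{\tau^\gamma}{1-\gamma}\Big(\frac{k}{c_1m}\Big)^{1-\gamma}(1+o(1))\Big).$$ (ii) If there exist $a,c_1>0$, $b\in\mathbb{R}$ and $\tau>1$ such that $\mathbb{P}(W\ge x)\sim a(\log x)^b\mathrm{e}^{-(\log(x)/c_1)^\tau}$ as $x\to\infty$, then $$p(k)=k^{-1}\exp\Big(-\Big(\frac{\log(k/m)}{c_1}\Big)^\tau\Big(1-\tau(\tau-1)\frac{\log\log(k/m)}{\log(k/m)}+\frac{K_{\tau,c_1}+o(1)}{\log(k/m)}\Big)\Big),$$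 where $K_{\tau,c_1}:=\tau\log(\mathrm{e}c_1^\tau/\tau)$. **(Fréchet)** Suppose $\mathbb{E}[W]=1$ and $\mathbb{P}(W\ge x)=\ell(x)x^{-(\alpha-1)}$ with $\alpha>2$ and $\ell$ non-negative and slowly varying at infinity. Then there are functions $\underline\ell,\overline\ell$ that are slowly varying at infinity such that for all $k\in\mathbb{N}$ $$\underline\ell(k)k^{-\alpha}\le p(k)\le\overline\ell(k)k^{-\alpha}.$$
   Context: $p(k)$ is the limiting in-degree distribution of the weighted recursive graph, in which each new vertex has $m$ half-edges that connect independently to an existing vertex with probability proportional to its vertex-weight, the vertex-weights being i.i.d. copies of $W$. A function $\ell$ is slowly varying at infinity if $\lim_{x\to\infty}\ell(cx)/\ell(x)=1$ for all $c>0$. $f\sim g$ means $f/g\to1$. $\mathbb{N}=\{1,2,\dots\}$, $\mathbb{N}_0=\{0,1,2,\dots\}$. *)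

(* Defs.v *)
From HB Require Import structures.
From mathcomp Require Import all_boot all_order all_algebra.
From mathcomp Require Import all_classical all_reals all_analysis.

Set Implicit Arguments.
Unset Strict Implicit.
Unset Printing Implicit Defensive.

Import Order.TTheory GRing.Theory Num.Theory.
Import numFieldNormedType.Exports.

Local Open Scope classical_set_scope.
Local Open Scope ring_scope.

Definition mean_weight (d : measure_display) (T : measurableType d)
    (R : realType) (P : probability T R) (W : {RV P >-> R}) : R :=
  fine 'E_P[W].

Definition indeg_dist (d : measure_display) (T : measurableType d)
    (R : realType) (P : probability T R) (W : {RV P >-> R})
    (m k : nat) : R :=
  let e := mean_weight W / m%:R in
  \int[distribution P W]_(x in `[0, +oo[) (e / (e + x) * (x / (e + x)) ^+ k).

Definition theta (d : measure_display) (T : measurableType d)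
    (R : realType) (P : probability T R) (W : {RV P >-> R}) (m : nat) : R :=
  1 + mean_weight W / m%:R.

Definition tail (d : measure_display) (T : measurableType d)
    (R : realType) (P : probability T R) (W : {RV P >-> R}) (x : R) : R :=
  fine (P [set t | x <= W t]).

(* The inverse is taken in the extended reals, where 0^-1 = +oo, so that an
   atom of W at 1 contributes to every tail. *)
Definition inv_gap_tail (d : measure_display) (T : measurableType d)
    (R : realType) (P : probability T R) (W : {RV P >-> R}) (x : R) : R :=
  fine (P [set t | (x%:E <= ((1 - W t)%:E)^-1)%E]).

Definition weight_sup (d : measure_display) (T : measurableType d)
    (R : realType) (P : probability T R) (W : {RV P >-> R}) : \bar R :=
  ereal_sup [set x%:E | x in [set x : R | 0 < x /\ (cdf W x < 1)%E]].

Definition slowly_varying (R : realType) (l : R -> R) : Prop :=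
  forall c : R, 0 < c -> (l (c * x) / l x) @[x --> +oo] --> (1 : R).

(* Positivity is part of the usual notion of slow variation.  The limit
   condition alone also holds for negative functions, such as the constant -1,
   for which a lower bound on a probability would be empty. *)
Definition positive_slowly_varying (R : realType) (l : R -> R) : Prop :=
  (forall x : R, 0 < x -> 0 < l x) /\ slowly_varying l.

Definition asymp_equiv (R : realType) (f g : R -> R) : Prop :=
  (f x / g x) @[x --> +oo] --> (1 : R).

(* [p(k) = F k (o(1)) as k -> oo] *)
Definition with_o1 (R : realType) (p : nat -> R) (F : nat -> R -> R) : Prop :=
  exists eps : nat -> R, eps k @[k --> \oo] --> (0 : R) /\
    \forall k \near \oo, p k = F k (eps k).

(* Main.v *)
Require Import Defs.
From HB Require Import structures.
From mathcomp Require Import all_boot all_order all_algebra.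
From mathcomp Require Import all_classical all_reals all_analysis.
From mathcomp Require Import measurable_realfun ring lra.

Set Implicit Arguments.
Unset Strict Implicit.
Unset Printing Implicit Defensive.

Import Order.TTheory GRing.Theory Num.Theory.
Import numFieldNormedType.Exports.

Local Open Scope classical_set_scope.
Local Open Scope ring_scope.

(** Put [e = E[W] / m].  Then [p(k)] is the expectation of
    [kern e k W = e / (e + W) * (W / (e + W)) ^+ k], and after a suitable
    normalisation the kernel behaves like [exp (- c k / z)] in a variable [z]
    that measures how far in its tail [W] is:
    - for unbounded [W], [k * kern e k x] is about [(e k / x) exp (- e k / x)],
      so [z = W] and [c = e], the factor [e k / x] being harmless;
    - for [W] bounded by 1, [theta ^+ k * kern e k x] is about
      [exp (- c k (1 - x))] with [c = 1 - theta^-1], so [z = (1 - W)^-1].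
    The normalised probability [q k] is thus comparable to the expectation of
    [exp (- c k / z)], a competition between this factor, which favours large
    [z], and the tail [H z], which makes large [z] rare.  A Laplace-type
    principle holds: up to factors which are harmless in all the regimes,
    [q k] is the supremum over [z] of [exp (- c k / z) * H z].

    The lower bound in this principle ([laplace_lower]) keeps only the values
    of [W] just beyond one level [z].  The upper bound ([laplace_upper]) cuts
    the range of [W] according to the dyadic size of the tail at [W]: the tail
    of a random variable, evaluated at that variable, is at most [u] with
    probability at most [u] ([tail_level]), so every slice contributes at most
    twice the supremum, and a number of slices logarithmic in the inverse
    of the result is enough ([integral_tail_le]).

    It remains to evaluate the supremum.
    - For [H z] about [exp (- (z / c1) `^ tau)] it is an instance of
      [u `^ tau + tau / u >= 1 + tau], with equality at [u = 1]
      ([stretched_upper], [stretched_lower]).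
    - For [H z] about [exp (- (ln z / c1) `^ tau)], put [z = k exp (- t)] and
      [L = ln k].  The convexity bound
      [(L - t) `^ tau >= L `^ tau - tau t L `^ (tau - 1)] reduces the problem
      to minimising [c exp t - B t] with [B] the slope of [(L / c1) `^ tau];
      the minimum [B (1 + ln c - ln B)] is the source of the [ln ln k] term
      and of the constant in the statement ([log_upper], [log_lower]).
    - For a regularly varying [H] the supremum is of the order of [H k], as
      [H z / H k] is at most polynomial in [k / z] ([dominated_upper],
      [dominated_lower]); the number of slices only costs a logarithm, which
      the slowly varying functions absorb ([regularly_varying_bounds]).

    If [W] has an atom at its supremum there is no competition: the normalised
    kernel tends to 0 below 1 and is constant at 1, so dominated convergence
    gives the limit ([bounded_atom]). *)

(** * The kernel *)

(** The integrand of the in-degree distribution, with [e = E[W] / m]. *)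
Definition kern (R : realType) (e : R) (k : nat) (x : R) : R :=
  e / (e + x) * (x / (e + x)) ^+ k.

Lemma kern_ge0 (R : realType) (e x : R) k : 0 < e -> 0 <= x -> 0 <= kern e k x.
Proof.
move=> e0 x0; have ex : 0 < e + x by rewrite ltr_wpDr.
by rewrite /kern mulr_ge0 ?exprn_ge0// divr_ge0// ltW.
Qed.

Lemma kern_gt0 (R : realType) (e x : R) k : 0 < e -> 0 < x -> 0 < kern e k x.
Proof.
move=> e0 x0; have ex : 0 < e + x by rewrite addr_gt0.
by rewrite /kern mulr_gt0 ?exprn_gt0// divr_gt0.
Qed.

Lemma kern_le1 (R : realType) (e x : R) k : 0 < e -> 0 <= x -> kern e k x <= 1.
Proof.
move=> e0 x0; have ex : 0 < e + x by rewrite ltr_wpDr.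
rewrite /kern mulr_ile1 ?exprn_ge0 ?exprn_ile1 ?divr_ge0//; try exact: ltW.
- by rewrite ler_pdivrMr// mul1r lerDl.
- by rewrite ler_pdivrMr// mul1r lerDr ltW.
Qed.

(** * Integrals and tails *)

Lemma measurable_gt (d : measure_display) (T : measurableType d) (R : realType)
    (f : T -> R) (x : R) :
  measurable_fun setT f -> measurable [set t | x < f t].
Proof.
move=> mf; rewrite (_ : [set t | _] = f @^-1` `]x, +oo[).
  by rewrite -[_ @^-1` _]setTI; exact: mf.
by apply/seteqP; split => t /=; rewrite in_itv/= andbT.
Qed.

Section integral_bounds.
Context (d : measure_display) (T : measurableType d) (R : realType).
Context (P : probability T R) (W : {RV P >-> R}).
Hypothesis W_ge0 : forall t, 0 <= W t.

Lemma measurable_le_W (x : R) : measurable [set t | x <= W t].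
Proof.
rewrite (_ : [set t | _] = W @^-1` `[x, +oo[).
  by rewrite -[_ @^-1` _]setTI; exact: measurable_funP.
by apply/seteqP; split => t /=; rewrite in_itv/= andbT.
Qed.

Lemma tailE (x : R) : (tail W x)%:E = P [set t | x <= W t].
Proof. by rewrite /tail fineK// fin_num_measure//; exact: measurable_le_W. Qed.

Lemma tail_ge0 (x : R) : 0 <= tail W x.
Proof. by rewrite -lee_fin tailE. Qed.

Lemma tail_le1 (x : R) : tail W x <= 1.
Proof. by rewrite -lee_fin tailE probability_le1//; exact: measurable_le_W. Qed.

Lemma tail_nonincreasing (x y : R) : x <= y -> tail W y <= tail W x.
Proof.
move=> xy; rewrite -lee_fin !tailE le_measure// ?inE; try exact: measurable_le_W.
by move=> t /=; exact: le_trans.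
Qed.

Lemma tail_le0 (x : R) : x <= 0 -> tail W x = 1.
Proof.
move=> x0; apply/eqP; rewrite -eqe tailE; apply/eqP.
rewrite (_ : [set t | _] = setT) ?probability_setT//.
by apply/seteqP; split => // t _ /=; exact: le_trans (W_ge0 t).
Qed.

(** The inverse is written as a power with exponent [-1], which is measurable on
    the whole line; the two agree because [e + W t >= 0]. *)
Lemma measurable_kern (e : R) k : 0 < e -> measurable_fun setT (fun t => kern e k (W t)).
Proof.
move=> e0.
have mi : measurable_fun [set: T] (fun t => (e + W t) `^ (-1)).
  apply: (measurableT_comp (measurable_powR (-1))).
  by apply: measurable_funD => //; exact: measurable_funP.
apply: (eq_measurable_fun
  (fun t => e * (e + W t) `^ (-1) * (W t * (e + W t) `^ (-1)) ^+ k)).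
  move=> t _; rewrite powR_inv1// addr_ge0//; exact: ltW.
apply: measurable_funM; first by apply: measurable_funM.
by apply: measurable_funX; apply: measurable_funM => //; exact: measurable_funP.
Qed.

Lemma indeg_dist_kern (m k : nat) (e : R) : e = mean_weight W / m%:R -> 0 < e ->
  indeg_dist W m k = fine (\int[P]_t (kern e k (W t))%:E)%E.
Proof.
move=> eE e0; rewrite /indeg_dist -eE /Rintegral; congr fine.
rewrite integral_mkcond.
under eq_integral => x _ do rewrite -/(kern e k x).
rewrite ge0_integral_distribution/=.
- apply: eq_integral => t _ /=; rewrite patchE ifT// inE/= in_itv/= andbT.
  exact: W_ge0.
- apply/(measurable_restrictT (EFin \o kern e k)) => //.
  apply/measurable_EFinP.
  have mi : measurable_fun (`[0, +oo[%classic : set R) (fun x : R => (e + x) `^ (-1)).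
    apply: measurable_funTS.
    apply: (measurableT_comp (measurable_powR (-1))).
    by apply: measurable_funD => //; exact: measurable_id.
  apply: (eq_measurable_fun
    (fun x : R => e * (e + x) `^ (-1) * (x * (e + x) `^ (-1)) ^+ k)).
    move=> x; rewrite inE/= in_itv/= andbT => x0.
    by rewrite powR_inv1// addr_ge0//; exact: ltW.
  apply: measurable_funM; first by apply: measurable_funM.
  by apply: measurable_funX; apply: measurable_funM.
- move=> y; rewrite patchE; case: ifPn => //; rewrite inE/= in_itv/= andbT => y0.
  by rewrite lee_fin kern_ge0.
Qed.

Lemma integral_kern_fin (e : R) k : 0 < e ->
  (\int[P]_t (kern e k (W t))%:E \is a fin_num)%E.
Proof.
move=> e0; rewrite ge0_fin_numE; last first.
  by apply: integral_ge0 => t _; rewrite lee_fin kern_ge0.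
apply: (@le_lt_trans _ _ (\int[P]_t (1%:E))%E); last first.
  by rewrite integral_cst// mul1e (le_lt_trans (probability_le1 _ _)) ?ltry.
apply: ge0_le_integral => //.
- by move=> t _; rewrite lee_fin kern_ge0.
- by apply/measurable_EFinP; exact: measurable_kern.
- by move=> t _; rewrite lee_fin kern_le1.
Qed.

Lemma measurable_tail_level (u : R) : measurable [set t | tail W (W t) <= u].
Proof.
have mt : measurable_fun setT (tail W).
  by apply: nonincreasing_measurable => // x y xy; exact: tail_nonincreasing.
have mW : measurable_fun setT (fun t => tail W (W t)) by exact: measurableT_comp.
rewrite (_ : [set t | _] = (fun t => tail W (W t)) @^-1` `]-oo, u]).
  by rewrite -[_ @^-1` _]setTI; exact: mW.
by apply/seteqP; split => t /=; rewrite in_itv.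
Qed.

(** The probability integral transform.  The level set is a half-line starting at its
    infimum [a].  If [a] belongs to it, its probability is [tail W a <= u];
    otherwise it is the increasing union of the half-lines starting at
    [a + 1 / (n + 1)], which all belong to the level set. *)
Lemma tail_level (u : R) : 0 <= u ->
  (P [set t | (tail W (W t) <= u)%R] <= u%:E)%E.
Proof.
move=> u0; have [u1|u1] := leP 1 u.
  rewrite (@le_trans _ _ 1%E) ?lee_fin//; apply: probability_le1.
  exact: measurable_tail_level.
set A := [set x | tail W x <= u].
have Apos x : A x -> 0 < x.
  rewrite /A/= ltNge => Ax; apply/negP => /tail_le0 tx.
  by move: Ax; rewrite tx leNgt u1.
have Aup x y : A x -> x <= y -> A y.
  by move=> Ax xy; apply: le_trans Ax; exact: tail_nonincreasing.
have [[x Ax]|nA] := pselect (exists x, A x); last first.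
  rewrite (_ : [set t | _] = set0) ?measure0 ?lee_fin//.
  by apply/seteqP; split => // t /= At; apply: nA; exists (W t).
have hA : has_inf A by split; [exists x|exists 0 => y /Apos /ltW].
set a := inf A.
have [Aa|nAa] := pselect (A a).
  rewrite (_ : [set t | _] = [set t | a <= W t]).
    by rewrite -tailE lee_fin.
  apply/seteqP; split => t /= At; first by apply: ge_inf => //; exact: (proj2 hA).
  exact: Aup Aa At.
have E : [set t | tail W (W t) <= u] =
    \bigcup_n [set t | a + n.+1%:R^-1 <= W t].
  apply/seteqP; split => t /=.
    move=> At; have : a < W t.
      rewrite lt_neqAle; apply/andP; split; last first.
        by apply: ge_inf => //; exact: (proj2 hA).
      by apply: contra_notN nAa => /eqP ->.
    by move=> /ltr_add_invr[n /ltW ?]; exists n.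
  move=> [n _ /=] nt.
  have an : a < W t by apply: lt_le_trans nt; rewrite ltrDl.
  have [y Ay yW] := inf_lt (proj1 hA) an.
  exact: Aup Ay (ltW yW).
have mF n : measurable [set t | a + n.+1%:R^-1 <= W t] by exact: measurable_le_W.
have := @nondecreasing_cvg_mu _ _ _ P (fun n => [set t | a + n.+1%:R^-1 <= W t]) mF.
rewrite -E => /(_ _ _)/cvg_lim; rewrite E => <- //.
- apply: lime_le.
    apply/cvg_ex; eexists; apply: nondecreasing_cvg_mu => //.
      exact: bigcup_measurable.
    move=> n p np; apply/subsetPset => t /=; apply: le_trans.
    by rewrite lerD2l lef_pV2 ?posrE// ler_nat.
  near=> n => /=; rewrite -tailE lee_fin.
  have an : a < a + n.+1%:R^-1 by rewrite ltrDl.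
  by have [y Ay /ltW yW] := inf_lt (proj1 hA) an; exact: Aup Ay yW.
- exact: bigcup_measurable.
- move=> n p np; apply/subsetPset => t /=; apply: le_trans.
  by rewrite lerD2l lef_pV2 ?posrE// ler_nat.
Unshelve. all: by end_near. Qed.

(** The upper half of the Laplace principle.  The hypothesis [f * tail <= S]
    says that no single level contributes more than [S]; integrating it
    directly would cost the possibly divergent integral of [1 / tail].  Cutting at the levels
    [2 ^- j] for [j < N], each of the [N] slices contributes at most [2 S],
    and the remaining event has probability at most [2 ^- N], where the bound
    [M] suffices. *)
Lemma integral_tail_le (f : R -> R) (S M : R) (N : nat) :
    measurable_fun setT (f \o W) -> (forall x : R, 0 <= x -> 0 <= f x) ->
    0 <= S -> 0 <= M ->
    (forall x : R, 0 <= x -> 0 < tail W x -> f x <= M) ->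
    (forall x : R, 0 <= x -> f x * tail W x <= S) ->
  (\int[P]_t (f (W t))%:E <= (2 * N%:R * S + M / 2 ^+ N)%:E)%E.
Proof.
move=> mf f0 S0 M0 fM fS.
pose A (j : nat) : set T := [set t | tail W (W t) <= (2 ^+ j)^-1].
have mA j : measurable (A j) by exact: measurable_tail_level.
have PA j : (P (A j) <= ((2 ^+ j)^-1)%:E)%E.
  by apply: tail_level; rewrite invr_ge0 exprn_ge0.
(* [h] dominates [f] wherever the tail does not vanish, which is almost
   everywhere. *)
pose h t := (\sum_(j < N) (S * 2 ^+ j.+1 * \1_(A j) t)%:E
            + (M * \1_(A N) t)%:E)%E.
have mSA (c : R) j : measurable_fun setT (fun t => (c * \1_(A j) t)%:E).
  by apply/measurable_EFinP; apply: measurable_funM => //; exact: measurable_indic.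
have SA0 (c : R) j t : 0 <= c -> (0 <= (c * \1_(A j) t)%:E)%E.
  by move=> c0; rewrite lee_fin mulr_ge0// indicE.
have c0 j : 0 <= S * 2 ^+ j by rewrite mulr_ge0// exprn_ge0.
have fh t : 0 < tail W (W t) -> ((f (W t))%:E <= h t)%E.
  move=> Wt; rewrite /h.
  have [AN|AN] := leP (tail W (W t)) (2 ^+ N)^-1.
    apply: (@le_trans _ _ (M * \1_(A N) t)%:E).
      by rewrite lee_fin indicE mem_set// mulr1 fM.
    by rewrite leeDr// sume_ge0// => j _; apply: SA0; exact: c0.
  suff H (n : nat) : (n <= N)%N -> (2 ^+ n)^-1 < tail W (W t) ->
      f (W t) <= \sum_(j < n) (S * 2 ^+ j.+1 * \1_(A j) t).
    rewrite sumEFin -EFinD lee_fin (le_trans (H N _ _))// lerDl.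
    by rewrite mulr_ge0// indicE.
  elim: n => [|n IH] nN; first by rewrite expr0 invr1 ltNge tail_le1.
  move=> nt; rewrite big_ord_recr/=.
  have [An|An] := leP (tail W (W t)) (2 ^+ n)^-1; last first.
    rewrite (le_trans (IH (ltnW nN) An))// lerDl mulr_ge0// indicE//.
  apply: (@le_trans _ _ (S * 2 ^+ n.+1 * \1_(A n) t)); last first.
    by rewrite lerDr sumr_ge0// => j _; rewrite mulr_ge0// indicE.
  rewrite indicE mem_set// mulr1 -ler_pdivrMr ?exprn_gt0//.
  rewrite (le_trans _ (fS (W t) (W_ge0 t)))//.
  by rewrite ler_wpM2l ?f0// ltW.
have mh : measurable_fun setT h.
  by apply: emeasurable_funD => //; apply: emeasurable_sum => j; exact: mSA.
have h0 t : (0 <= h t)%E.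
  by rewrite /h adde_ge0 ?SA0// sume_ge0// => j _; apply: SA0; exact: c0.
apply: (@le_trans _ _ (\int[P]_t h t)%E).
  apply: ae_ge0_le_integral => //.
  - by move=> t _; rewrite lee_fin f0.
  - by apply/measurable_EFinP.
  - exists [set t | tail W (W t) <= 0]; split.
    + exact: measurable_tail_level.
    + by apply/eqP; rewrite eq_le measure_ge0 andbT tail_level.
    + move=> t /=; apply: contra_notP => /negP; rewrite -ltNge => Wt _.
      exact: fh.
rewrite /h ge0_integralD//; last 3 first.
- by move=> t _; rewrite sume_ge0// => j _; apply: SA0; exact: c0.
- by apply: emeasurable_sum => j; exact: mSA.
- by move=> t _; exact: SA0.
rewrite ge0_integral_sum//; last first.
  by move=> j t _; apply: SA0; exact: c0.
have I (c : R) j : 0 <= c ->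
    (\int[P]_t (c * \1_(A j) t)%:E <= (c / 2 ^+ j)%:E)%E.
  move=> cge; under eq_integral do rewrite EFinM.
  rewrite ge0_integralZl//; last by apply/measurable_EFinP; exact: measurable_indic.
  rewrite integral_indic// setIT EFinM.
  by apply: lee_wpmul2l; [rewrite lee_fin|exact: PA].
rewrite EFinD leeD ?I//.
apply: (@le_trans _ _ (\sum_(j < N) (2 * S)%:E)%E).
  apply: lee_sum => j _; apply: le_trans (I _ _ _) _; first exact: c0.
  by rewrite lee_fin exprS mulrCA mulrA mulfK ?expf_neq0// mulrC.
by rewrite sumEFin lee_fin sumr_const card_ord -[_ *+ N]mulr_natl mulrCA mulrA.
Qed.

(** The lower half of the Laplace principle: a single slice. *)
Lemma integral_interval_ge (f : R -> R) (s x1 x2 : R) :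
    measurable_fun setT (f \o W) -> (forall x : R, 0 <= x -> 0 <= f x) ->
    0 <= s -> x1 <= x2 ->
    (forall x : R, 0 <= x -> x1 <= x < x2 -> s <= f x) ->
  ((s * (tail W x1 - tail W x2))%:E <= \int[P]_t (f (W t))%:E)%E.
Proof.
move=> mf f0 s0 x12 sf.
pose B := [set t | x1 <= W t] `\` [set t | x2 <= W t].
have mB : measurable B by apply: measurableD; exact: measurable_le_W.
apply: (@le_trans _ _ (\int[P]_t (s * \1_B t)%:E)%E).
  under eq_integral do rewrite EFinM.
  rewrite ge0_integralZl//; last first.
    by apply/measurable_EFinP; exact: measurable_indic.
  rewrite integral_indic// setIT EFinM.
  apply: lee_wpmul2l; first by rewrite lee_fin.
  rewrite measureD.
  - rewrite EFinB !tailE setIidr// => t /=; exact: le_trans.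
  - exact: measurable_le_W.
  - exact: measurable_le_W.
  - rewrite (le_lt_trans (probability_le1 _ _)) ?ltry//; exact: measurable_le_W.
apply: ge0_le_integral => //.
- by move=> t _; rewrite lee_fin mulr_ge0// indicE.
- apply/measurable_EFinP; apply: measurable_funM => //; exact: measurable_indic.
- by apply/measurable_EFinP.
- move=> t _; rewrite lee_fin indicE.
  case: (boolP (t \in B)) => [/set_mem[/= t1 /negP t2]|_]; last by rewrite mulr0 f0.
  by rewrite mulr1 sf// t1 ltNge.
Qed.

Lemma ae_gt0_integral (f : T -> R) :
    measurable_fun setT f -> (forall t, 0 <= f t) -> P [set t | 0 < f t] = 1%E ->
  (0 < \int[P]_t (f t)%:E)%E.
Proof.
move=> mf f0 Pf; rewrite lt_neqAle integral_ge0 ?andbT; last first.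
  by move=> t _; rewrite lee_fin.
apply/eqP => /esym I0.
have mE : measurable_fun setT (EFin \o f) by apply/measurable_EFinP.
have : (\int[P]_t `|(EFin \o f) t| = 0)%E.
  by rewrite -[RHS]I0; apply: eq_integral => t _ /=; rewrite ger0_norm.
move=> /(ae_eq_integral_abs _ measurableT mE).1 [N [mN N0 fN]].
have : (P [set t | (0 < f t)%R] <= P N)%E.
  rewrite le_measure ?inE//.
    exact: measurable_gt.
  move=> t /= ft; apply: fN => /=; move/(_ I) => [] f00.
  by move: ft; rewrite f00 ltxx.
by rewrite Pf N0 lee_fin ler10.
Qed.

End integral_bounds.

(** * The Laplace principle for the in-degree distribution *)

(** The estimate of [q k] from below by the value of [exp (- c k / z) * H z] at
    one point.  The factor [1 + e] absorbs the difference between the kernel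
    and the exponential.  The range [z <= c k] contains, up to a constant
    factor, the best choice of [z] in all the regimes, and it keeps [c k / z] away from 0, which
    is what makes the factor [c k / z] of the unbounded kernel harmless. *)
Definition laplace_lower (R : realType) (q : nat -> R) (c : R) (H : R -> R) :=
  forall e : R, 0 < e -> exists C Z : R, [/\ 0 < C, 0 < Z &
    forall (k : nat) (z : R), Z <= z -> z <= c * k%:R ->
      C * expR (- ((1 + e) * (c * k%:R / z))) * H z <= q k].

(** The estimate of [q k] from above: if [exp (- s)] dominates
    [exp (- c k / z) * H z] for all large [z], with a margin [1 - e] in the
    exponent of the kernel, then [q k] exceeds it by at most
    a factor of the order of the number of slices.  The values below [Z]
    contribute a quantity which is exponentially small in [k], whence the
    restriction [s <= eta * k]; since [Z] is arbitrary, the asymptotic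
    knowledge of [H] is enough. *)
Definition laplace_upper (R : realType) (q : nat -> R) (c : R) (H : R -> R) :=
  forall e Z : R, 0 < e < 1 -> 0 < Z -> exists C eta : R, [/\ 0 < C, 0 < eta &
    forall (k : nat) (s : R), (0 < k)%N -> 0 <= s <= eta * k%:R ->
      (forall z, Z <= z ->
        expR (- ((1 - e) * (c * k%:R / z))) * H z <= expR (- s)) ->
      q k <= C * (1 + ln k%:R + s) * expR (- s)].

Lemma kern_mul_expn (R : realType) (e th : R) k x :
  kern e k x * th ^+ k = e / (e + x) * (x * th / (e + x)) ^+ k.
Proof. by rewrite /kern -mulrA -exprMn; congr (_ * _ ^+ _); ring. Qed.

Lemma expR_half_le2 (R : realType) : expR (2^-1) <= 2 :> R.
Proof.
have h : (2^-1 : R) <= expR (- 2^-1).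
  by have := expR_ge1Dx (- 2^-1 : R); lra.
by move: h; rewrite expRN lef_pV2 ?posrE ?expR_gt0.
Qed.

Lemma kern_ge_exp (R : realType) (e z x : R) (k : nat) : 0 < e -> e <= z ->
  z <= e * k%:R -> z <= x < 2 * z ->
  (3 * k%:R)^-1 * expR (- (e * k%:R / z)) <= kern e k x.
Proof.
move=> e0 ez zk /andP[zx xz].
have z0 : 0 < z := lt_le_trans e0 ez.
have x0 : 0 < x := lt_le_trans z0 zx.
have k0 : 0 < k%:R :> R by rewrite -(pmulr_rgt0 _ e0) (lt_le_trans z0).
rewrite /kern; apply: ler_pM; rewrite ?expR_ge0//.
- rewrite ler_pdivlMr ?addr_gt0// ler_pdivrMl ?mulr_gt0//; lra.
- rewrite (_ : - _ = k%:R * (- (e / z))); last by field; rewrite gt_eqF.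
  rewrite expRM_natl lerXn2r ?nnegrE ?expR_ge0 ?divr_ge0 ?addr_ge0 ?(ltW x0) ?(ltW e0)//.
  apply: (@le_trans _ _ (z / (e + z))); last first.
    by rewrite ler_pdivlMr ?addr_gt0// mulrAC ler_pdivrMr ?addr_gt0//; nra.
  rewrite expRN -[leRHS]invf_div lef_pV2 ?posrE ?expR_gt0 ?divr_gt0 ?addr_gt0//.
  by rewrite mulrDl divff ?gt_eqF// addrC; exact: expR_ge1Dx.
Qed.

Lemma kern_le_exp (R : realType) (e x : R) (k : nat) : 0 < e -> 0 <= x ->
  k%:R * kern e k x <= e * k%:R / (e + x) * expR (- (e * k%:R / (e + x))).
Proof.
move=> e0 x0; set u := e * k%:R / (e + x); have ex : 0 < e + x by rewrite ltr_wpDr.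
have u0 : 0 <= u by rewrite divr_ge0 ?mulr_ge0 ?(ltW e0) ?(ltW ex).
rewrite /kern mulrA (_ : k%:R * _ = u); last by rewrite /u; field; rewrite gt_eqF.
rewrite ler_wpM2l//.
rewrite (_ : - u = k%:R * (- (e / (e + x)))); last by rewrite /u; field; rewrite gt_eqF.
rewrite expRM_natl lerXn2r ?nnegrE ?expR_ge0 ?divr_ge0 ?(ltW ex)//.
rewrite (le_trans _ (expR_ge1Dx _))// le_eqVlt; apply/orP; left; apply/eqP.
by field; rewrite gt_eqF.
Qed.

(** The factor [u] is paid for by a small part of the exponential. *)
Lemma xexpN_le (R : realType) (u eps : R) : 0 < eps -> 0 <= u ->
  u * expR (- u) <= 2 / eps * expR (- ((1 - eps / 2) * u)).
Proof.
move=> eps0 u0.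
rewrite (_ : - ((1 - eps / 2) * u) = eps / 2 * u + - u); last by ring.
rewrite expRD mulrA ler_wpM2r ?expR_ge0// -ler_pdivrMl ?divr_gt0//.
rewrite invf_div; have := expR_ge1Dx (eps / 2 * u); lra.
Qed.

Lemma ratio_shift (R : realType) (e x eps : R) : 0 < e -> 0 < x -> 0 < eps < 1 ->
  2 * e / eps <= x -> (1 - eps) / x <= (1 - eps / 2) / (e + x).
Proof.
move=> e0 x0 /andP[eps0 eps1].
rewrite !ler_pdivrMr// mulrAC ler_pdivlMr ?addr_gt0//; nra.
Qed.

(** [x * (1 + e) / (e + x)] is [1 - e (1 - x) / (e + x)], and [e + x <= 1 + e]. *)
Lemma kern_theta_le (R : realType) (e x : R) (k : nat) : 0 < e -> 0 <= x <= 1 ->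
  kern e k x * (1 + e) ^+ k <= expR (- ((1 - (1 + e)^-1) * k%:R * (1 - x))).
Proof.
move=> e0 /andP[x0 x1].
have ex : 0 < e + x by rewrite ltr_wpDr.
have e1 : 0 < 1 + e by rewrite addr_gt0.
rewrite kern_mul_expn -[leRHS]mul1r; apply: ler_pM.
- by rewrite divr_ge0 ?(ltW e0) ?(ltW ex).
- by rewrite exprn_ge0// divr_ge0 ?mulr_ge0 ?(ltW e1) ?(ltW ex).
- by rewrite ler_pdivrMr// mul1r lerDl.
rewrite (_ : - _ = k%:R * (- ((1 - (1 + e)^-1) * (1 - x)))); last by ring.
rewrite expRM_natl lerXn2r ?nnegrE ?expR_ge0//.
  by rewrite divr_ge0 ?mulr_ge0 ?(ltW e1) ?(ltW ex).
apply: le_trans (expR_ge1Dx _).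
rewrite (_ : 1 - (1 + e)^-1 = e / (1 + e)); last by field; rewrite gt_eqF.
rewrite (_ : 1 - e / (1 + e) * (1 - x) = (1 + e * x) / (1 + e)); last first.
  by field; rewrite gt_eqF.
rewrite ler_pdivrMr// mulrAC ler_pdivlMr//.
have : 0 <= e * ((1 - x) * (1 - x)).
  by rewrite mulr_ge0 ?(ltW e0) ?mulr_ge0// subr_ge0.
have : 0 <= e * (e * ((1 - x) * x)).
  by rewrite !mulr_ge0 ?(ltW e0) ?mulr_ge0// subr_ge0.
lra.
Qed.

(** At [x = 1 - z^-1] the inverse of [x * (1 + e) / (e + x)] is
    [1 + c / (z - 1)], at most [exp (c / (z - 1))], with
    [c = 1 - (1 + e)^-1]; this factor of the kernel increases in [x], and the
    other one is at least [e / (e + 2)] below 2, a point chosen beyond the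
    supremum 1 of the weights. *)
Lemma kern_theta_ge (R : realType) (e z x : R) (k : nat) : 0 < e -> 1 < z ->
  1 - z^-1 <= x < 2 ->
  e / (e + 2) * expR (- ((1 - (1 + e)^-1) * k%:R / (z - 1)))
    <= kern e k x * (1 + e) ^+ k.
Proof.
move=> e0 z1 /andP[zx x2].
have z0 : 0 < z by rewrite (lt_trans _ z1).
have zB : 0 < z - 1 by rewrite subr_gt0.
have y0 : 0 < 1 - z^-1 by rewrite subr_gt0 invf_lt1.
have x0 : 0 < x := lt_le_trans y0 zx.
have ex : 0 < e + x by rewrite addr_gt0.
have e1 : 0 < 1 + e by rewrite addr_gt0.
rewrite kern_mul_expn; apply: ler_pM; rewrite ?expR_ge0//.
- by rewrite divr_ge0 ?(ltW e0)// addr_ge0 ?(ltW e0).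
- by rewrite ler_pM2l// lef_pV2 ?posrE ?addr_gt0// lerD2l ltW.
rewrite (_ : - _ = k%:R * (- ((1 - (1 + e)^-1) / (z - 1)))); last by ring.
rewrite expRM_natl lerXn2r ?nnegrE ?expR_ge0//.
  by rewrite divr_ge0 ?mulr_ge0 ?(ltW e1) ?(ltW ex) ?(ltW x0).
apply: (@le_trans _ _ ((1 - z^-1) * (1 + e) / (e + (1 - z^-1)))); last first.
  move: zx y0; move: (1 - z^-1) => y yx y0.
  have ey : 0 < e + y by rewrite addr_gt0.
  rewrite ler_pdivrMr// mulrAC ler_pdivlMr//.
  have : 0 <= (x - y) * (e * (1 + e)).
    by rewrite !mulr_ge0 ?subr_ge0 ?(ltW e0) ?(ltW e1).
  lra.
have ey0 : 0 < e + (1 - z^-1) by rewrite addr_gt0.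
have ye0 : 0 < (1 - z^-1) * (1 + e) by rewrite mulr_gt0.
rewrite expRN -[leRHS]invf_div lef_pV2 ?posrE ?expR_gt0 ?(divr_gt0 ey0 ye0)//.
apply: le_trans (expR_ge1Dx _).
rewrite le_eqVlt; apply/orP; left; apply/eqP.
by field; rewrite !gt_eqF.
Qed.

Section indeg.
Context (d : measure_display) (T : measurableType d) (R : realType).
Context (P : probability T R) (W : {RV P >-> R}) (m : nat) (e : R).
Hypothesis W_ge0 : forall t, 0 <= W t.
Hypothesis eE : e = mean_weight W / m%:R.
Hypothesis e_gt0 : 0 < e.

Let mkern k : measurable_fun setT (kern e k \o W) := measurable_kern W_ge0 k e_gt0.
Let kern0 k (x : R) : 0 <= x -> 0 <= kern e k x := kern_ge0 k e_gt0.

Lemma indeg_fineK k : (indeg_dist W m k)%:E = (\int[P]_t (kern e k (W t))%:E)%E.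
Proof.
by rewrite (indeg_dist_kern W_ge0 k eE e_gt0) fineK//; exact: integral_kern_fin.
Qed.

Lemma indeg_ge k (s x1 x2 : R) : 0 <= s -> x1 <= x2 ->
  (forall x : R, 0 <= x -> x1 <= x < x2 -> s <= kern e k x) ->
  s * (tail W x1 - tail W x2) <= indeg_dist W m k.
Proof.
move=> s0 x12 H; rewrite -lee_fin indeg_fineK.
by apply: (integral_interval_ge W_ge0 (mkern k)) => //; exact: kern0.
Qed.

Lemma indeg_gt0 k : P [set t | 0 < W t] = 1%E -> 0 < indeg_dist W m k.
Proof.
move=> PW; rewrite -lte_fin indeg_fineK; apply: (ae_gt0_integral (mkern k)).
  by move=> t; exact: kern0.
have mk := measurable_gt 0 (mkern k).
apply/eqP; rewrite eq_le -{2}PW probability_le1//= le_measure ?inE//.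
  by apply: measurable_gt; exact: measurable_funP.
by move=> t /=; exact: kern_gt0.
Qed.

(** [integral_tail_le] with enough slices for the remainder
    [M / 2 ^+ N] to be at most [S]. *)
Lemma indeg_le k (S M : R) : 0 < S -> S <= M ->
  (forall x : R, 0 <= x -> 0 < tail W x -> kern e k x <= M) ->
  (forall x : R, 0 <= x -> kern e k x * tail W x <= S) ->
  indeg_dist W m k <= (3 + 4 * ln (M / S)) * S.
Proof.
move=> S0 SM HM HS; have M0 : 0 < M := lt_le_trans S0 SM.
have l0 : 0 <= ln (M / S) by rewrite ln_ge0// ler_pdivlMr// mul1r.
set N := (Num.truncn (2 * ln (M / S))).+1.
have N1 : 2 * ln (M / S) < N%:R by rewrite truncnS_gt.
have N2 : N%:R <= 2 * ln (M / S) + 1.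
  by rewrite /N -natr1 lerD2r truncn_le ?mulr_ge0.
have MN : M / 2 ^+ N <= S.
  rewrite ler_pdivrMr ?exprn_gt0// -ler_pdivrMl// mulrC.
  apply: (@le_trans _ _ (expR (2^-1) ^+ N)).
    rewrite -expRM_natl -[leLHS]lnK ?posrE ?divr_gt0// ler_expR.
    lra.
  by rewrite lerXn2r ?nnegrE ?expR_ge0 ?expR_half_le2.
have : indeg_dist W m k <= 2 * N%:R * S + M / 2 ^+ N.
  rewrite -lee_fin indeg_fineK.
  apply: (integral_tail_le W_ge0 N (mkern k)) => //; try exact: kern0; exact: ltW.
move=> /le_trans; apply.
rewrite (_ : (3 + _) * S = 2 * (2 * ln (M / S) + 1) * S + S); last by ring.
rewrite lerD// ler_wpM2r ?(ltW S0)// ler_wpM2l//.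
Qed.

Section unbounded.
Variable (rho : R).
Hypothesis rho1 : rho < 1.
Hypothesis tail_doubling : \forall z \near +oo, tail W (2 * z) <= rho * tail W z.

(** The factor [e / (e + x)] of the kernel decreases, so the slice
    stops at [2 * z]; the hypothesis on [tail W (2 * z)] guarantees that it carries a
    positive proportion of the tail. *)
Lemma laplace_lower_unbounded :
  laplace_lower (fun k => k%:R * indeg_dist W m k) e (tail W).
Proof.
move=> eps eps0; have [Z1 [_ HZ1]] := tail_doubling.
pose Z := Num.max (Z1 + 1) e.
have Z0 : 0 < Z by rewrite lt_max e_gt0 orbT.
exists ((1 - rho) / 3), Z; split => //; first by rewrite divr_gt0// subr_gt0.
move=> k z Zz zk.
have z0 : 0 < z := lt_le_trans Z0 Zz.
have ez : e <= z by apply: le_trans Zz; rewrite le_max lexx orbT.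
have Z1z : Z1 < z.
  by apply: lt_le_trans Zz; rewrite lt_max ltrDl ltr01.
have ek0 : 0 < e * k%:R := lt_le_trans z0 zk.
have k0 : 0 < k%:R :> R by rewrite -(pmulr_rgt0 _ e_gt0).
set s := (3 * k%:R)^-1 * expR (- (e * k%:R / z)).
have s0 : 0 <= s by rewrite mulr_ge0 ?expR_ge0// invr_ge0 mulr_ge0// ltW.
have : s * (tail W z - tail W (2 * z)) <= indeg_dist W m k.
  apply: indeg_ge => //; first by rewrite ler_peMl ?ler1n// ltW.
  by move=> x _; exact: kern_ge_exp.
have Gz := HZ1 _ Z1z.
move=> H; rewrite [leRHS]mulrC -ler_pdivrMr//.
apply: le_trans H; rewrite /s.
rewrite invfM.
have E1 : expR (- ((1 + eps) * (e * k%:R / z))) <= expR (- (e * k%:R / z)).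
  rewrite ler_expR lerN2 mulrDl mul1r lerDl mulr_ge0 ?divr_ge0 ?ltW//.
have G0 := tail_ge0 W z.
set E := expR _ in E1 *; set F := expR _ in E1 *.
have F0 : 0 <= F by exact: expR_ge0.
rewrite (_ : (1 - rho) / 3 * E * tail W z / k%:R =
   (3^-1 / k%:R * E) * ((1 - rho) * tail W z)); last by field; rewrite gt_eqF.
have k3 : 0 <= 3^-1 / k%:R :> R by rewrite divr_ge0// ltW.
apply: ler_pM.
- by rewrite mulr_ge0// expR_ge0.
- by rewrite mulr_ge0// subr_ge0 ltW.
- by rewrite ler_wpM2l.
- by rewrite mulrBl mul1r lerD2l lerN2.
Qed.

End unbounded.

Lemma laplace_upper_unbounded :
  laplace_upper (fun k => k%:R * indeg_dist W m k) e (tail W).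
Proof.
move=> eps Z /andP[eps0 eps1] Z0.
pose Y := Num.max Z (2 * e / eps).
have ZY : Z <= Y by rewrite le_max lexx.
have Y0 : 0 < Y := lt_le_trans Z0 ZY.
(* For [x < Y] the exponent [e k / (e + x)] is at least [e k / (e + Y)], and
   at least half of it is left after [xexpN_le]. *)
pose eta := 2^-1 * (e / (e + Y)).
have eta0 : 0 < eta by rewrite mulr_gt0 ?divr_gt0 ?addr_gt0.
exists (8 / eps), eta; split => //; first by rewrite divr_gt0.
move=> k s k0 /andP[s0 sk] H.
have kR : 0 < k%:R :> R by rewrite ltr0n.
have k1 : 1 <= k%:R :> R by rewrite ler1n.
pose S := 2 / eps * expR (- s) / k%:R.
pose M := 2 / eps.
have M0 : 0 < M by rewrite divr_gt0.
have M1 : 1 <= M by rewrite ler_pdivlMr// mul1r (le_trans (ltW eps1))// ler1n.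
have S0 : 0 < S by rewrite !(mulr_gt0, divr_gt0, expR_gt0, invr_gt0).
have SM : S <= M.
  rewrite /S /M ler_pdivrMr// ler_pM2l// (le_trans _ k1)//.
  by rewrite expR_le1 oppr_le0.
have kernu x : 0 <= x ->
    k%:R * kern e k x <= 2 / eps * expR (- ((1 - eps / 2) * (e * k%:R / (e + x)))).
  move=> x0; have ex : 0 < e + x by rewrite ltr_wpDr.
  apply: le_trans (kern_le_exp k e_gt0 x0) (xexpN_le eps0 _).
  by rewrite divr_ge0 ?mulr_ge0 ?(ltW e_gt0) ?addr_ge0 ?(ltW e_gt0).
have kS x : 0 <= x -> kern e k x * tail W x <= S.
  move=> x0; rewrite /S ler_pdivlMr// mulrC mulrA.
  apply: (@le_trans _ _ (2 / eps * expR (- ((1 - eps / 2) * (e * k%:R / (e + x)))) * tail W x)).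
    by rewrite ler_wpM2r ?tail_ge0// kernu.
  rewrite -mulrA; apply: ler_wpM2l; first exact: ltW.
  have ex : 0 < e + x by rewrite ltr_wpDr.
  have [Yx|xY] := leP Y x.
    apply: le_trans (H x (le_trans ZY Yx)).
    have xp : 0 < x := lt_le_trans Y0 Yx.
    rewrite ler_wpM2r ?tail_ge0// ler_expR lerN2.
    rewrite (_ : _ * (e * k%:R / x) = e * k%:R * ((1 - eps) / x)); last by ring.
    rewrite (_ : _ * (e * k%:R / (e + x)) = e * k%:R * ((1 - eps / 2) / (e + x))); last by ring.
    apply: ler_wpM2l; first by rewrite mulr_ge0// ltW.
    apply: ratio_shift => //; first by rewrite eps0.
    by apply: le_trans Yx; rewrite le_max lexx orbT.
  apply: (@le_trans _ _ (expR (- (eta * k%:R)) * 1)); last first.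
    by rewrite mulr1 ler_expR lerN2.
  rewrite ler_pM ?expR_ge0 ?tail_ge0 ?tail_le1// ler_expR lerN2.
  rewrite (_ : eta * k%:R = 2^-1 * (e * k%:R / (e + Y))); last first.
    by rewrite /eta; ring.
  have ekR : 0 < e * k%:R by rewrite mulr_gt0.
  rewrite ler_pM//.
  - by rewrite divr_ge0 ?ltW// addr_gt0.
  - by rewrite lerBrDl -lerBrDr ler_pdivrMr//; lra.
  - by rewrite ler_pM2l// lef_pV2 ?posrE ?(addr_gt0 e_gt0 Y0)// lerD2l ltW.
have kM x : 0 <= x -> 0 < tail W x -> kern e k x <= M.
  by move=> x0 _; apply: le_trans M1; exact: kern_le1.
have := indeg_le S0 SM kM kS.
have -> : ln (M / S) = ln k%:R + s.
  rewrite (_ : M / S = k%:R * expR s).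
    by rewrite lnM ?posrE ?expR_gt0// expRK.
  rewrite /S -/M expRN; field.
  by rewrite !gt_eqF ?expR_gt0.
move=> H1; rewrite (le_trans (ler_wpM2l (ltW kR) H1))//.
rewrite (_ : k%:R * _ = 2 / eps * expR (- s) * (3 + 4 * (ln k%:R + s))); last first.
  by rewrite /S; field; rewrite !gt_eqF.
rewrite (_ : 8 / eps * _ * _ = 2 / eps * expR (- s) * (4 * (1 + ln k%:R + s))); last first.
  by field; rewrite gt_eqF.
rewrite ler_wpM2l//; first by rewrite mulr_ge0 ?expR_ge0// ltW.
lra.
Qed.


Section bounded.
Hypothesis tail1 : forall x, 1 < x -> tail W x = 0.

(** As the weights do not exceed 1, the whole tail beyond [1 - z^-1] can be
    kept. *)
Lemma laplace_lower_bounded :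
  laplace_lower (fun k => indeg_dist W m k * (1 + e) ^+ k) (1 - (1 + e)^-1)
    (fun z => tail W (1 - z^-1)).
Proof.
move=> eps eps0.
have Z0 : 0 < 1 + eps^-1 by rewrite addr_gt0// invr_gt0.
have e2 : 0 < e + 2 by rewrite addr_gt0.
exists (e / (e + 2)), (1 + eps^-1); split => //; first by rewrite divr_gt0.
move=> k z Zz _.
have th0 : 0 < (1 + e) ^+ k by rewrite exprn_gt0// addr_gt0.
have z1 : 1 < z by apply: lt_le_trans Zz; rewrite ltrDl invr_gt0.
have z0 : 0 < z := lt_trans ltr01 z1.
set s := e / (e + 2) * expR (- ((1 - (1 + e)^-1) * k%:R / (z - 1))).
have s0 : 0 <= s by rewrite mulr_ge0 ?expR_ge0// divr_ge0 ?(ltW e_gt0) ?(ltW e2).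
have c0 : 0 <= (1 - (1 + e)^-1) * k%:R.
  by rewrite mulr_ge0// subr_ge0 invf_le1 ?lerDl ?addr_gt0// ltW.
have : s / (1 + e) ^+ k * (tail W (1 - z^-1) - tail W 2) <= indeg_dist W m k.
  apply: indeg_ge; first by rewrite divr_ge0// ltW.
    by rewrite lerBlDr (@le_trans _ _ 2)// ?ler1n// lerDl invr_ge0 ltW.
  move=> x _ zx; rewrite ler_pdivrMr//; exact: kern_theta_ge.
have -> : tail W 2 = 0 by apply: tail1; rewrite ltr1n.
rewrite subr0 mulrAC ler_pdivrMr//; apply: le_trans.
apply: ler_wpM2r; first exact: tail_ge0.
apply: ler_wpM2l; first by rewrite divr_ge0 ?(ltW e_gt0) ?(ltW e2).
rewrite ler_expR lerN2 mulrCA; apply: ler_wpM2l => //.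
rewrite -[(z - 1)^-1]mul1r ler_pdivrMr ?subr_gt0// mulrAC ler_pdivlMr// mul1r.
move: Zz; rewrite -lerBrDl -[eps^-1]mul1r ler_pdivrMr//; lra.
Qed.

(** The point [x = 1] corresponds to [z = +oo]; there the tail is compared with
    its value at a level [z] of the order of [k], at the cost of the constant
    [expR 1]. *)
Lemma laplace_upper_bounded :
  laplace_upper (fun k => indeg_dist W m k * (1 + e) ^+ k) (1 - (1 + e)^-1)
    (fun z => tail W (1 - z^-1)).
Proof.
move=> eps Z /andP[eps0 eps1] Z0.
set c := 1 - (1 + e)^-1.
have c0 : 0 < c by rewrite subr_gt0 invf_lt1 ?ltrDl ?addr_gt0.
(* Below [Z], that is for [1 - x >= Z^-1], the kernel is at most
   [exp (- (c / Z) k)]. *)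
exists (4 * expR 1), (c / Z); split; [by rewrite mulr_gt0 ?expR_gt0|by rewrite divr_gt0|].
move=> k s k0 /andP[s0 sk] H.
have kR : 0 < k%:R :> R by rewrite ltr0n.
have ck0 : 0 < c * k%:R by rewrite mulr_gt0.
have th0 : 0 < (1 + e) ^+ k by rewrite exprn_gt0// addr_gt0.
have e1 : 1 <= expR 1 :> R by rewrite -[leLHS]expR0 ler_expR.
pose S := expR 1 * expR (- s) / (1 + e) ^+ k.
pose M := expR 1 / (1 + e) ^+ k.
have S0 : 0 < S by rewrite divr_gt0 ?mulr_gt0 ?expR_gt0.
have SM : S <= M.
  rewrite /S /M ler_pM2r ?invr_gt0// -[leRHS]mulr1 ler_pM2l ?expR_gt0//.
  by rewrite expR_le1 oppr_le0.
have ks x : 0 <= x <= 1 -> kern e k x * (1 + e) ^+ k <= expR (- (c * k%:R * (1 - x))).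
  exact: kern_theta_le.
have kM x : 0 <= x -> 0 < tail W x -> kern e k x <= M.
  move=> x0 tx; have x1 : x <= 1.
    by rewrite leNgt; apply/negP => /tail1 t0; rewrite t0 ltxx in tx.
  rewrite ler_pdivlMr// (le_trans (ks _ _)) ?x0//.
  by rewrite (le_trans _ e1)// expR_le1 oppr_le0 mulr_ge0 ?(ltW ck0) ?subr_ge0.
have kS x : 0 <= x -> kern e k x * tail W x <= S.
  move=> x0; rewrite ler_pdivlMr// mulrAC.
  have [x1|x1] := ltP 1 x.
    by rewrite tail1// mulr0 mulr_ge0// expR_ge0.
  have {ks} := ks x; rewrite x0 x1 => /(_ isT) ks.
  apply: (le_trans (ler_wpM2r (tail_ge0 W x) ks)).
  move: x1; rewrite le_eqVlt => /predU1P[x1|x1].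
    pose z := Num.max Z (c * k%:R).
    have z0 : 0 < z by rewrite lt_max Z0.
    have ckz : c * k%:R / z <= 1.
      by rewrite ler_pdivrMr// mul1r le_max lexx orbT.
    have Zz : Z <= z by rewrite le_max lexx.
    rewrite x1 subrr mulr0 oppr0 expR0 mul1r.
    have tz : tail W 1 <= tail W (1 - z^-1).
      by apply: tail_nonincreasing; rewrite lerBlDr lerDl invr_ge0 ltW.
    apply: (le_trans tz).
    rewrite -ler_pdivrMl ?expR_gt0// -expRN.
    apply: le_trans (H z Zz); apply: ler_wpM2r; first exact: tail_ge0.
    rewrite ler_expR lerN2 -[leRHS]mulr1; apply: ler_pM => //.
    - by rewrite subr_ge0 ltW.
    - by rewrite divr_ge0 ?(ltW ck0) ?(ltW z0).
    - by rewrite lerBlDr lerDl ltW.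
  have x1B : 0 < 1 - x by rewrite subr_gt0.
  have [Zx|Zx] := leP Z (1 - x)^-1.
    have := H _ Zx; rewrite invrK subKr => Hx.
    apply: (@le_trans _ _ (expR (- s))); last first.
      by rewrite ler_peMl ?expR_ge0.
    apply: le_trans Hx; apply: ler_wpM2r; first exact: tail_ge0.
    rewrite ler_expR lerN2; apply: ler_piMl.
      by rewrite mulr_ge0 ?(ltW ck0) ?(ltW x1B).
    by rewrite lerBlDr lerDl ltW.
  apply: (@le_trans _ _ (expR (- s) * 1)); last first.
    by rewrite mulr1 ler_peMl ?expR_ge0.
  apply: ler_pM; rewrite ?expR_ge0 ?tail_ge0 ?tail_le1//.
  rewrite ler_expR lerN2 (le_trans sk)// mulrAC ler_pM2l//.
  by rewrite -[leRHS]invrK lef_pV2 ?posrE ?invr_gt0 ?(ltW Zx).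
have := indeg_le S0 SM kM kS.
have -> : ln (M / S) = s.
  rewrite (_ : M / S = expR s) ?expRK//.
  rewrite /S /M expRN; field.
  by rewrite !gt_eqF ?expR_gt0.
rewrite -(ler_pM2r th0) => /le_trans; apply.
rewrite (_ : _ * S * _ = expR 1 * expR (- s) * (3 + 4 * s)); last first.
  by rewrite /S; field; rewrite gt_eqF.
rewrite (_ : 4 * expR 1 * _ * _ = expR 1 * expR (- s) * (4 * (1 + ln k%:R + s))); last by ring.
apply: ler_wpM2l; first by rewrite mulr_ge0 ?expR_ge0.
rewrite !mulrDr mulr1 lerD2r -[leLHS]addr0 lerD ?mulr_ge0 ?ln_ge0 ?ler1n//.
by rewrite ler_nat.
Qed.

End bounded.
End indeg.

(** * Growth at infinity *)

Section near_infinity.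
Context (R : realType).
Implicit Types (C D eps s : R).

Lemma powRD_gt0 (x r s : R) : 0 < x -> x `^ (r + s) = x `^ r * x `^ s.
Proof. by move=> x0; rewrite powRD// (gt_eqF x0) implybT. Qed.

Lemma near_pinfty_ge C : \forall x \near +oo, C <= x :> R.
Proof. by exists C; split; [exact: num_real|move=> x /ltW]. Qed.

Lemma near_pinfty_gt C : \forall x \near +oo, C < x :> R.
Proof. by exists C; split; [exact: num_real|]. Qed.

Lemma near_le_powR C s : 0 < s -> \forall y \near +oo, C <= (y : R) `^ s.
Proof.
move=> s0; near=> y.
have M1 : 1 <= Num.max 1 C by rewrite le_max lexx.
have M0 : 0 < Num.max 1 C by rewrite (lt_le_trans _ M1).
apply: (@le_trans _ _ (Num.max 1 C)); first by rewrite le_max lexx orbT.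
rewrite -[leLHS]powRr1 ?(ltW M0)// -(@mulVf _ s) ?gt_eqF// powRrM.
apply: ge0_ler_powR; rewrite ?nnegrE ?powR_ge0 ?(ltW s0)//.
Unshelve. all: by end_near. Qed.

(** [ln u <= u] at [u = x `^ s]. *)
Lemma ln_le_powR (s x : R) : 0 < s -> 0 < x -> ln x <= s^-1 * x `^ s.
Proof.
move=> s0 x0; rewrite ler_pdivlMl// -ln_powR ltW// ln_sublinear//.
exact: powR_gt0.
Qed.

Lemma near_ln_le_powR C D eps s : 0 < eps -> 0 < s ->
  \forall y \near +oo, C + D * ln y <= eps * (y : R) `^ s.
Proof.
move=> eps0 s0; set s2 := s / 2.
have s20 : 0 < s2 by rewrite divr_gt0.
set M := `|C| + `|D| * s2^-1.
near=> y.
have y1 : 1 <= y by near: y; exact: near_pinfty_ge.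
have y0 : 0 < y := lt_le_trans ltr01 y1.
have ys1 : 1 <= y `^ s2 by rewrite -(powRr0 y) ler_powR// ltW.
have yM : M / eps <= y `^ s2 by near: y; exact: near_le_powR.
have -> : y `^ s = y `^ s2 * y `^ s2.
  by rewrite -powRD_gt0//; congr (_ `^ _); rewrite /s2; field.
rewrite mulrA; apply: (@le_trans _ _ (M * y `^ s2)); last first.
  by rewrite ler_wpM2r ?powR_ge0// mulrC -ler_pdivrMr.
rewrite /M mulrDl lerD//.
  by rewrite (le_trans (ler_norm _))// ler_peMr.
rewrite -mulrA (le_trans (ler_wpM2r _ (ler_norm D))) ?ln_ge0//.
by rewrite ler_wpM2l// ln_le_powR.
Unshelve. all: by end_near. Qed.

Lemma near_ln_ge C : \forall x \near +oo, C <= ln x :> R.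
Proof.
near=> x.
have xA : expR C <= x by near: x; exact: near_pinfty_ge.
by rewrite -[C]expRK ler_ln ?posrE ?expR_gt0// (lt_le_trans _ xA) ?expR_gt0.
Unshelve. all: by end_near. Qed.

Lemma cvg_ln_pinfty : @ln R x @[x --> +oo] --> +oo.
Proof. by apply/cvgryPge => A; exact: near_ln_ge. Qed.

Lemma cvg_mul_natr_pinfty (c : R) : 0 < c -> c * k%:R @[k --> \oo] --> +oo.
Proof.
move=> c0; apply/cvgryPge => A; near=> k.
rewrite -ler_pdivrMl//; near: k; exact: nbhs_infty_ger.
Unshelve. all: by end_near. Qed.

Lemma near_natr (Q : R -> Prop) :
  (\forall y \near +oo, Q y) -> \forall k \near \oo, Q (k%:R : R).
Proof.
move=> HQ; near=> k; rewrite -[k%:R]mul1r.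
by near: k; exact: (@cvg_mul_natr_pinfty 1 ltr01 _ HQ).
Unshelve. all: by end_near. Qed.

End near_infinity.

(** * Stretched exponential tails *)

(** The minimum over [z > 0] of [lam / z + (z / c1) `^ tau]. *)
Definition stretched_rate (R : realType) (c1 tau lam : R) : R :=
  let gamma := 1 / (tau + 1) in
  tau `^ gamma / (1 - gamma) * (lam / c1) `^ (1 - gamma).

Section stretched_exponential.
Context (R : realType) (c1 tau : R).
Hypotheses (c1_gt0 : 0 < c1) (tau_gt0 : 0 < tau).

Local Notation rate := (stretched_rate c1 tau).

Let gamma := 1 / (tau + 1).
(** The value of [z] at which this minimum is attained. *)
Let zopt (lam : R) := c1 * (lam / (c1 * tau)) `^ gamma.

Let gamma_gt0 : 0 < gamma.
Proof. by rewrite divr_gt0// addr_gt0. Qed.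

Let onemgamma : 1 - gamma = tau * gamma.
Proof. by rewrite /gamma; field; rewrite gt_eqF// addr_gt0. Qed.

Let onemgamma_gt0 : 0 < 1 - gamma.
Proof. by rewrite onemgamma mulr_gt0. Qed.

Let zopt_gt0 lam : 0 < lam -> 0 < zopt lam.
Proof. by move=> l0; rewrite mulr_gt0// powR_gt0// divr_gt0// mulr_gt0. Qed.

Let zopt_powR lam : 0 < lam ->
  (zopt lam / c1) `^ tau = (lam / (c1 * tau)) `^ (1 - gamma).
Proof.
move=> l0; rewrite /zopt mulrAC divff ?gt_eqF// mul1r -powRrM.
by rewrite onemgamma [gamma * tau]mulrC.
Qed.

Let zopt_div lam : 0 < lam ->
  lam / zopt lam = tau * (lam / (c1 * tau)) `^ (1 - gamma).
Proof.
move=> l0; set x := lam / (c1 * tau).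
have x0 : 0 < x by rewrite divr_gt0// mulr_gt0.
rewrite powRD_gt0// powRN powRr1 ?(ltW x0)//.
rewrite /zopt -/x {1}(_ : lam = c1 * tau * x).
  by field; rewrite !gt_eqF// powR_gt0.
by rewrite /x; field; rewrite !gt_eqF.
Qed.

Let rateE lam : 0 < lam ->
  rate lam = (1 + tau) * (lam / (c1 * tau)) `^ (1 - gamma).
Proof.
move=> l0; rewrite /stretched_rate -/gamma (_ : lam / c1 = tau * (lam / (c1 * tau))); last first.
  by field; rewrite !gt_eqF.
rewrite powRM ?(ltW tau_gt0)//; last by rewrite divr_ge0 ?mulr_ge0 ?ltW.
rewrite mulrA; congr (_ * _).
rewrite mulrAC -powRD_gt0//.
rewrite addrC subrK powRr1 ?(ltW tau_gt0)// onemgamma /gamma.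
by field; rewrite !gt_eqF// addr_gt0.
Qed.

Let rate_optE lam : 0 < lam ->
  lam / zopt lam + (zopt lam / c1) `^ tau = rate lam.
Proof. by move=> l0; rewrite rateE// zopt_div// zopt_powR// addrC mulrDl mul1r. Qed.

(** In the variable [v = ln (z / zopt lam)] the objective is proportional to
    [tau * exp (- v) + exp (v * tau)], and [1 + x <= exp x] twice gives
    [1 + tau]. *)
Let rate_le lam z : 0 < lam -> 0 < z -> rate lam <= lam / z + (z / c1) `^ tau.
Proof.
move=> l0 z0; have zo0 := zopt_gt0 l0.
set v := ln (z / zopt lam).
have zE : z = zopt lam * expR v.
  by rewrite /v lnK ?posrE ?divr_gt0// mulrC divfK// gt_eqF.
set M := (lam / (c1 * tau)) `^ (1 - gamma).
have M0 : 0 <= M by exact: powR_ge0.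
have -> : lam / z = tau * M * expR (- v).
  by rewrite /M -zopt_div// zE expRN invfM mulrA.
have -> : (z / c1) `^ tau = M * expR (v * tau).
  rewrite {1}zE mulrAC powRM ?expR_ge0 ?divr_ge0 ?(ltW c1_gt0) ?(ltW zo0)//.
  by rewrite zopt_powR// -expRM.
rewrite rateE// -/M.
rewrite (_ : tau * M * _ + _ = M * (tau * expR (- v) + expR (v * tau))); last by ring.
rewrite mulrC ler_wpM2l//.
have := ler_wpM2l (ltW tau_gt0) (expR_ge1Dx (- v)).
have := expR_ge1Dx (v * tau).
lra.
Qed.

Let rate_ge0 lam : 0 < lam -> 0 <= rate lam.
Proof.
by move=> l0; rewrite rateE// mulr_ge0 ?powR_ge0// addr_ge0 ?(ltW tau_gt0).
Qed.

Let rate_natE (c : R) : 0 < c -> exists2 K : R, 0 < K &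
  forall k : nat, rate (c * k%:R) = K * k%:R `^ (1 - gamma).
Proof.
move=> c0; exists (tau `^ gamma / (1 - gamma) * (c / c1) `^ (1 - gamma)).
  by rewrite mulr_gt0 ?divr_gt0 ?powR_gt0 ?divr_gt0.
move=> k; rewrite /stretched_rate -/gamma (_ : c * k%:R / c1 = c / c1 * k%:R); last by ring.
by rewrite powRM ?mulrA// divr_ge0 ?(ltW c0) ?(ltW c1_gt0).
Qed.

Lemma near_rate_ln (c C D eps : R) : 0 < c -> 0 < eps ->
  \forall k \near \oo, C + D * ln k%:R <= eps * rate (c * k%:R).
Proof.
move=> c0 eps0; have [K K0 KE] := rate_natE c0.
near=> k; rewrite KE mulrA.
near: k; apply: (near_natr (Q := fun y => C + D * ln y <= eps * K * y `^ (1 - gamma))).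
by apply: near_ln_le_powR => //; rewrite mulr_gt0.
Unshelve. all: by end_near. Qed.

(** Half of [e] absorbs the errors in the kernel and in the tail, the other
    half the number of slices, which is at most linear in [k]. *)
Lemma stretched_upper (q : nat -> R) (c : R) (H : R -> R) : 0 < c ->
  laplace_upper q c H ->
  (forall e, 0 < e -> \forall z \near +oo,
     H z <= expR (- ((1 - e) * (z / c1) `^ tau))) ->
  forall e, 0 < e < 1 ->
    \forall k \near \oo, q k <= expR (- ((1 - e) * rate (c * k%:R))).
Proof.
move=> c0 qH HH e /andP[e0 e1].
set e' := e / 2.
have e'0 : 0 < e' by rewrite divr_gt0.
have e'1 : e' < 1 by rewrite /e' ltr_pdivrMr// mul1r (lt_trans e1)// ltr1n.
have e'1B : 0 <= 1 - e' by rewrite subr_ge0 ltW.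
have [Z1 [_ HZ1]] := HH e' e'0.
pose Z := Num.max 1 (Z1 + 1).
have Z0 : 0 < Z by rewrite lt_max ltr01.
have e'01 : 0 < e' < 1 by rewrite e'0.
have [C [eta [C0 eta0 up]]] := qH e' Z e'01 Z0.
have [K K0 KE] := rate_natE c0.
near=> k.
have k0 : (0 < k)%N by near: k; exists 1%N.
have kR : 0 < k%:R :> R by rewrite ltr0n.
have ck : 0 < c * k%:R by rewrite mulr_gt0.
set r := rate (c * k%:R).
have r0 : 0 <= r by exact: rate_ge0.
have rk : r <= eta * k%:R.
  have kE : k%:R = k%:R `^ gamma * k%:R `^ (1 - gamma) :> R.
    by rewrite -powRD_gt0// addrC subrK powRr1 ?(ltW kR).
  rewrite /r KE {2}kE mulrA; apply: ler_wpM2r; first exact: powR_ge0.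
  rewrite -ler_pdivrMl// mulrC.
  near: k; apply: (near_natr (Q := fun y => K / eta <= y `^ gamma)).
  exact: near_le_powR.
have s0 : 0 <= (1 - e') * r <= eta * k%:R.
  rewrite mulr_ge0//=; apply: le_trans rk.
  by rewrite ler_piMl// lerBlDr lerDl ltW.
have := up k _ k0 s0 => /(_ _)/le_trans; apply.
  move=> z Zz; have z0 : 0 < z := lt_le_trans Z0 Zz.
  have Z1z : Z1 < z.
    by apply: lt_le_trans Zz; rewrite lt_max ltrDl ltr01 orbT.
  apply: le_trans (ler_wpM2l (expR_ge0 _) (HZ1 _ Z1z)) _.
  rewrite -expRD ler_expR -opprD lerN2 -mulrDr ler_wpM2l//.
  exact: rate_le.
have lk0 : 0 <= ln (k%:R : R) by rewrite ln_ge0// ler1n.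
have lkk : ln (k%:R : R) <= k%:R by rewrite ltW// ln_sublinear.
have k1 : 1 <= k%:R :> R by rewrite ler1n.
have C2 : 0 < C * (2 + eta) by rewrite mulr_gt0// addr_gt0.
have B1 : C * (1 + ln k%:R + (1 - e') * r) <= C * (2 + eta) * k%:R.
  rewrite -mulrA ler_wpM2l ?(ltW C0)//.
  by case/andP: s0 => _ s1; lra.
have B2 : C * (2 + eta) * k%:R <= expR (e' * r).
  have Ck0 : 0 < C * (2 + eta) * k%:R by rewrite mulr_gt0.
  rewrite -[leLHS]lnK ?posrE// ler_expR lnM ?posrE//.
  rewrite -[ln k%:R]mul1r /r; near: k; exact: near_rate_ln.
apply: le_trans (ler_wpM2r (expR_ge0 _) (le_trans B1 B2)) _.
rewrite -expRD ler_expR /e'.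
by rewrite le_eqVlt; apply/orP; left; apply/eqP; field.
Unshelve. all: by end_near. Qed.

(** The Laplace lower bound at the minimiser, which tends to infinity but more
    slowly than [k]. *)
Lemma stretched_lower (q : nat -> R) (c : R) (H : R -> R) : 0 < c ->
  laplace_lower q c H ->
  (forall e, 0 < e -> \forall z \near +oo,
     expR (- ((1 + e) * (z / c1) `^ tau)) <= H z) ->
  forall e, 0 < e ->
    \forall k \near \oo, expR (- ((1 + e) * rate (c * k%:R))) <= q k.
Proof.
move=> c0 qH HH e e0.
set e' := e / 2.
have e'0 : 0 < e' by rewrite divr_gt0.
have [Z1 [_ HZ1]] := HH e' e'0.
have [C [Z [C0 Z0 low]]] := qH e' e'0.
have zoo : zopt (c * k%:R) @[k --> \oo] --> +oo.
  have -> : (fun k : nat => zopt (c * k%:R)) =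
      (fun k : nat => c1 * ((c / (c1 * tau)) `^ gamma * k%:R `^ gamma)).
    apply/funext => k.
    have ct : 0 <= c / (c1 * tau).
      by rewrite divr_ge0 ?mulr_ge0 ?(ltW c0) ?(ltW c1_gt0) ?(ltW tau_gt0).
    by rewrite -powRM// /zopt [c * _ / _]mulrAC.
  have K0 : 0 < c1 * (c / (c1 * tau)) `^ gamma.
    by rewrite mulr_gt0// powR_gt0 ?divr_gt0 ?mulr_gt0.
  apply/cvgryPge => A; near=> k.
  rewrite mulrA -ler_pdivrMl// mulrC.
  near: k; apply: (near_natr (Q := fun y => A / _ <= y `^ gamma)).
  exact: near_le_powR.
near=> k.
have k0 : (0 < k)%N by near: k; exists 1%N.
have kR : 0 < k%:R :> R by rewrite ltr0n.
have ck : 0 < c * k%:R by rewrite mulr_gt0.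
have zo0 := zopt_gt0 ck.
set r := rate (c * k%:R).
have Zz : Z <= zopt (c * k%:R).
  by near: k; exact: (zoo _ (near_pinfty_ge Z)).
have Z1z : Z1 < zopt (c * k%:R).
  by near: k; exact: (zoo _ (near_pinfty_gt Z1)).
have zck : zopt (c * k%:R) <= c * k%:R.
  rewrite -[leLHS]mul1r -ler_pdivlMr// zopt_div// -ler_pdivrMl// mulr1.
  near: k; apply: (@cvg_mul_natr_pinfty R c c0
    (fun y => tau^-1 <= (y / (c1 * tau)) `^ (1 - gamma))).
  have ct : 0 < (c1 * tau)^-1 by rewrite invr_gt0 mulr_gt0.
  near=> y; have y0 : 0 <= y by near: y; exact: near_pinfty_ge.
  rewrite powRM ?(ltW ct)//.
  rewrite -ler_pdivrMr ?powR_gt0//.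
  by near: y; exact: near_le_powR.
apply: le_trans (low k _ Zz zck).
have B : expR (- (e' * r)) <= C.
  rewrite -[leRHS]lnK ?posrE// ler_expR lerNl.
  rewrite -[leLHS]addr0 -(mul0r (ln k%:R)) /r; near: k; exact: near_rate_ln.
have HZ := HZ1 _ Z1z.
apply: le_trans (ler_wpM2l _ HZ); last by rewrite mulr_ge0 ?expR_ge0 ?ltW.
rewrite -[leRHS]mulrA -expRD.
apply: le_trans (ler_wpM2r (expR_ge0 _) B).
rewrite -expRD ler_expR -!opprD lerN2 -mulrDr rate_optE// -/r /e'.
by rewrite le_eqVlt; apply/orP; left; apply/eqP; field.
Unshelve. all: by end_near. Qed.

End stretched_exponential.

(** * Tails that are stretched exponential in the logarithm *)

Section log_stretched.
Context (R : realType) (b tau c rho : R).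
Hypotheses (b_gt0 : 0 < b) (tau_gt1 : 1 < tau) (c_gt0 : 0 < c) (rho_gt0 : 0 < rho).

(** The derivative of [L |-> b * L `^ tau]: the price in the tail exponent of
    one unit of [ln z]. *)
Definition log_slope (L : R) : R := b * tau * L `^ (tau - 1).

(** The minimum over [t] of [c * exp t + b * L `^ tau - log_slope L * t], where
    [t = L - ln z] and the last two terms linearise [b * (L - t) `^ tau]. *)
Definition log_rate (L : R) : R :=
  b * L `^ tau + log_slope L * (1 + ln c - ln (log_slope L)).

Let tau_gt0 : 0 < tau. Proof. exact: lt_trans tau_gt1. Qed.
Let taum1_gt0 : 0 < tau - 1. Proof. by rewrite subr_gt0. Qed.
Let btau_gt0 : 0 < b * tau. Proof. by rewrite mulr_gt0. Qed.

Lemma powR_pred (L s : R) : 0 < L -> L `^ s = L * L `^ (s - 1).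
Proof.
by move=> L0; rewrite -{2}(powRr1 (ltW L0)) -powRD_gt0// addrC subrK.
Qed.

Lemma log_slope_gt0 L : 0 < L -> 0 < log_slope L.
Proof. by move=> L0; rewrite mulr_gt0// powR_gt0. Qed.

Lemma ln_log_slope L : 0 < L ->
  ln (log_slope L) = ln (b * tau) + (tau - 1) * ln L.
Proof. by move=> L0; rewrite /log_slope lnM ?posrE ?powR_gt0// ln_powR. Qed.

(** The graph of [x `^ tau] is above its tangent at [L].  After division by
    [L `^ tau] this is Young's inequality for the exponents [tau] and
    [tau / (tau - 1)] applied to [l / L] and 1. *)
Lemma powR_bernoulli_ge (l L : R) : 0 < l -> 0 < L ->
  L `^ tau + tau * (l - L) * L `^ (tau - 1) <= l `^ tau.
Proof.
move=> l0 L0.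
have Lt0 : 0 < L `^ tau by exact: powR_gt0.
have -> : l `^ tau = L `^ tau * (l / L) `^ tau.
  have lL0 : 0 <= l / L by rewrite divr_ge0 ?(ltW l0) ?(ltW L0).
  by rewrite -powRM ?(ltW L0)// mulrC divfK// gt_eqF.
apply: (@le_trans _ _ (L `^ tau * (1 + tau * (l / L - 1)))).
  rewrite le_eqVlt; apply/orP; left; apply/eqP.
  by rewrite (powR_pred tau L0); field; rewrite gt_eqF.
rewrite ler_pM2l//.
set u := l / L; have u0 : 0 < u by rewrite divr_gt0.
have q0 : 0 < tau / (tau - 1) by rewrite divr_gt0.
have pq : tau^-1 + (tau / (tau - 1))^-1 = 1 by field; rewrite !gt_eqF.
have := conjugate_powR (ltW u0) (@ler01 R) tau_gt0 q0 pq.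
rewrite mulr1 powR1 mul1r invf_div => H.
have : u * tau <= (u `^ tau / tau + (tau - 1) / tau) * tau by rewrite ler_pM2r.
rewrite -mulrDl divfK ?gt_eqF//; lra.
Qed.

(** The converse of the tangent bound up to a second order term, from
    [(1 - w / L) `^ tau <= exp (- x) <= 1 / (1 + x) <= 1 - x + x ^+ 2] with
    [x = tau * w / L]. *)
Lemma powR_bernoulli_le (w L : R) : 0 < L -> 0 <= w < L ->
  (L - w) `^ tau <= L `^ tau - tau * w * L `^ (tau - 1)
     + tau ^+ 2 * (w ^+ 2 / L) * L `^ (tau - 1).
Proof.
move=> L0 /andP[w0 wL]; set x := tau * w / L.
have x0 : 0 <= x by rewrite divr_ge0 ?mulr_ge0 ?(ltW tau_gt0) ?(ltW L0).
have l0 : 0 < 1 - w / L by rewrite subr_gt0 ltr_pdivrMr// mul1r.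
have -> : L - w = L * (1 - w / L) by field; rewrite gt_eqF.
rewrite powRM ?(ltW L0) ?(ltW l0)//.
rewrite (_ : _ - _ + _ = L `^ tau * (1 - x + x ^+ 2)); last first.
  by rewrite /x (powR_pred tau L0); field; rewrite gt_eqF.
rewrite ler_pM2l ?powR_gt0//.
apply: (@le_trans _ _ (expR (- x))).
  rewrite (_ : - x = - (w / L) * tau); last by rewrite /x; field; rewrite gt_eqF.
  rewrite expRM; apply: ge0_ler_powR; rewrite ?nnegrE ?(ltW tau_gt0) ?(ltW l0) ?expR_ge0//.
  exact: expR_ge1Dx.
have x1 : 0 < 1 + x by rewrite ltr_wpDr.
apply: (@le_trans _ _ (1 + x)^-1).
  by rewrite expRN lef_pV2 ?posrE ?expR_gt0// expR_ge1Dx.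
rewrite -[leLHS]mul1r ler_pdivrMr//.
have : 0 <= x ^+ 3 by exact: exprn_ge0.
lra.
Qed.

Let L_ (k : nat) : R := ln (rho * k%:R).

Let cvg_L : L_ k @[k --> \oo] --> +oo.
Proof.
move=> Q HQ; exact: (cvg_mul_natr_pinfty rho_gt0 (cvg_ln_pinfty HQ)).
Qed.

Let near_L (Q : R -> Prop) : (\forall y \near +oo, Q y) ->
  \forall k \near \oo, Q (L_ k).
Proof. by move=> HQ; exact: (cvg_L HQ). Qed.

Let slope_expR (L : R) x : 0 < L ->
  log_slope L * expR (x + ln c - ln (log_slope L)) = c * expR x.
Proof.
move=> L0; have B0 := log_slope_gt0 L0.
rewrite expRB expRD !lnK ?posrE//; field.
by rewrite gt_eqF.
Qed.

(** For [l <= L] the tangent bound and [1 + x <= exp x] give exactly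
    [log_rate].  For [l > L] the tail alone is smaller than at [L], where it
    already costs [b * L `^ tau >= log_rate L]; the two conditions on [L] hold
    as soon as it is large. *)
Lemma log_rate_min (L l delta e1 : R) : 0 < L -> 0 < l -> 0 <= delta -> 0 < e1 ->
  1 + ln c <= ln (log_slope L) -> e1 <= b * L ->
  log_rate L - delta * log_slope L - e1 * L `^ (tau - 1) <=
  expR (- delta) * (c * expR (L - l)) + (b * l `^ tau - e1 * l `^ (tau - 1)).
Proof.
move=> L0 l0 d0 e10 cL eL; have B0 := log_slope_gt0 L0.
have t0 : 0 <= tau - 1 := ltW taum1_gt0.
have [lL|Ll] := leP l L.
  rewrite (mulrCA (expR (- delta))) -expRD -(slope_expR _ L0).
  set E := - delta + (L - l) + ln c - ln (log_slope L).
  have h1 : log_slope L * (1 + E) <= log_slope L * expR E.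
    by rewrite ler_pM2l// expR_ge1Dx.
  have h2 := ler_wpM2l (ltW b_gt0) (powR_bernoulli_ge l0 L0).
  have h3 : e1 * l `^ (tau - 1) <= e1 * L `^ (tau - 1).
    by rewrite ler_pM2l// ge0_ler_powR// nnegrE ltW.
  rewrite /log_rate; move: h1 h2 h3; rewrite /E /log_slope.
  lra.
have h1 : 0 <= expR (- delta) * (c * expR (L - l)).
  by rewrite !mulr_ge0 ?expR_ge0// ltW.
have h2 : log_slope L * (1 + ln c - ln (log_slope L)) <= 0.
  by rewrite pmulr_rle0// subr_le0.
have h3 : L `^ (tau - 1) * (b * L - e1) <= l `^ (tau - 1) * (b * l - e1).
  apply: ler_pM; rewrite ?powR_ge0 ?subr_ge0//.
    by rewrite ge0_ler_powR ?nnegrE ?(ltW L0) ?(ltW l0) ?(ltW Ll).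
  by rewrite lerD2r ler_pM2l// ltW.
have h4 : 0 <= delta * log_slope L by rewrite mulr_ge0// ltW.
rewrite /log_rate (powR_pred tau L0) (powR_pred tau l0).
lra.
Qed.

Let near_Lln (C D e s : R) : 0 < e -> 0 < s ->
  \forall k \near \oo, C + D * ln (L_ k) <= e * L_ k `^ s.
Proof. by move=> e0 s0; exact: (near_L (near_ln_le_powR _ _ e0 s0)). Qed.

Let near_Lln1 (C D e : R) : 0 < e ->
  \forall k \near \oo, C + D * ln (L_ k) <= e * L_ k.
Proof.
move=> e0; near=> k; have L1 : 0 <= L_ k.
  by near: k; exact: (near_L (near_pinfty_ge _)).
by rewrite -[X in e * X]powRr1//; near: k; apply: near_Lln.
Unshelve. all: by end_near. Qed.

Lemma near_log_powR (eta : R) : 0 < eta ->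
  \forall k \near \oo, b * L_ k `^ tau <= eta * k%:R.
Proof.
move=> eta0; near=> k.
have k0 : 0 < k%:R :> R by rewrite ltr0n; near: k; exists 1%N.
have L0 : 0 < L_ k by near: k; exact: (near_L (near_pinfty_gt _)).
have e0 : 0 < eta / rho by rewrite divr_gt0.
have rk : 0 < rho * k%:R by rewrite mulr_gt0.
have -> : eta * k%:R = eta / rho * expR (L_ k).
  by rewrite lnK ?posrE//; field; rewrite gt_eqF.
rewrite -ler_pdivrMl// -[leLHS]lnK ?ler_expR; last first.
  by rewrite posrE !mulr_gt0 ?invr_gt0// powR_gt0.
rewrite mulrA lnM ?posrE ?powR_gt0 ?mulr_gt0 ?invr_gt0// ln_powR.
by rewrite -[leRHS]mul1r; near: k; apply: near_Lln1.
Unshelve. all: by end_near. Qed.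

(** The precision needed is [o(L `^ (tau - 1))].  A factor [exp (- delta)] in
    front of [c] changes [log_rate] by [delta * log_slope L], which is of this
    order, so [delta] is chosen proportional to [e]; the number of slices is
    polynomial in [L] and its logarithm is negligible. *)
Lemma log_upper (q : nat -> R) (H : R -> R) :
  laplace_upper q (c * rho) H ->
  (forall e, 0 < e -> \forall z \near +oo,
     H z <= expR (- (b * ln z `^ tau - e * ln z `^ (tau - 1)))) ->
  forall e, 0 < e -> \forall k \near \oo,
    q k <= expR (- (log_rate (L_ k) - e * L_ k `^ (tau - 1))).
Proof.
move=> qH HH e e0.
have e30 : 0 < e / 3 by rewrite divr_gt0.
(* This makes [delta * log_slope L] equal to [e / 3 * L `^ (tau - 1)]. *)
pose delta := e / (3 * (b * tau)).
have delta0 : 0 < delta by rewrite divr_gt0// mulr_gt0.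
have e'01 : 0 < 1 - expR (- delta) < 1.
  by rewrite subr_gt0 expR_lt1 oppr_lt0 delta0/= ltrBlDr ltrDl expR_gt0.
have [Z1 [_ HZ1]] := HH _ e30.
pose Z := Num.max 2 (Z1 + 1).
have Z0 : 0 < Z by rewrite lt_max ltr0n.
have [C [eta [C0 eta0 up]]] := qH _ Z e'01 Z0.
have deltaE L : delta * log_slope L = e / 3 * L `^ (tau - 1).
  by rewrite /delta /log_slope; field; rewrite !gt_eqF.
near=> k.
have k0 : (0 < k)%N by near: k; exists 1%N.
have kR : 0 < k%:R :> R by rewrite ltr0n.
have rk : 0 < rho * k%:R by rewrite mulr_gt0.
have L1 : 1 <= L_ k by near: k; exact: (near_L (near_pinfty_ge _)).
have L0 : 0 < L_ k := lt_le_trans ltr01 L1.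
have P0 : 0 < L_ k `^ (tau - 1) by exact: powR_gt0.
have slope_big : 1 + ln c <= ln (log_slope (L_ k)).
  rewrite ln_log_slope// -lerBlDl.
  have tt : (tau - 1)^-1 * (1 + ln c - ln (b * tau)) <= ln (L_ k).
    by near: k; exact: (near_L (near_ln_ge _)).
  by rewrite -ler_pdivrMl.
have e_small : e / 3 <= b * L_ k.
  by rewrite -ler_pdivrMl//; near: k; exact: (near_L (near_pinfty_ge _)).
have rate_le : log_rate (L_ k) <= b * L_ k `^ tau.
  rewrite /log_rate gerDl pmulr_rle0 ?log_slope_gt0// subr_le0//.
have rate_ge : 0 <= log_rate (L_ k) - e / 3 * L_ k `^ (tau - 1) - e / 3 * L_ k `^ (tau - 1).
  have H1 : (b * tau) * (ln (b * tau) - 1 - ln c) + e / 3 + e / 3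
      + b * tau * (tau - 1) * ln (L_ k) <= b * L_ k.
    by near: k; apply: near_Lln1.
  have := ler_wpM2l (ltW P0) H1.
  rewrite /log_rate ln_log_slope// /log_slope (powR_pred tau L0).
  lra.
set s := log_rate (L_ k) - e / 3 * L_ k `^ (tau - 1) - e / 3 * L_ k `^ (tau - 1).
have sL : s <= b * L_ k `^ tau.
  have : 0 <= e / 3 * L_ k `^ (tau - 1) by rewrite mulr_ge0// ltW.
  rewrite /s; lra.
have bLk : b * L_ k `^ tau <= eta * k%:R by near: k; exact: near_log_powR.
have s0 : 0 <= s <= eta * k%:R by rewrite rate_ge (le_trans sL bLk).
have := up k _ k0 s0 => /(_ _)/le_trans; apply.
  move=> z Zz; have z0 : 0 < z := lt_le_trans Z0 Zz.
  have Z1z : Z1 < z.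
    by apply: lt_le_trans Zz; rewrite lt_max ltrDl ltr01 orbT.
  have z2 : 1 < z by apply: lt_le_trans Zz; rewrite lt_max ltr1n.
  apply: le_trans (ler_wpM2l (expR_ge0 _) (HZ1 _ Z1z)) _.
  rewrite -expRD ler_expR -opprD lerN2 subKr.
  rewrite (_ : c * rho * k%:R / z = c * expR (L_ k - ln z)); last first.
    by rewrite expRB !lnK ?posrE// /L_; ring.
  rewrite /s -[X in _ - X - _]deltaE.
  apply: log_rate_min => //; [exact: ln_gt0|exact: ltW].
have lk : ln (k%:R : R) = L_ k - ln rho.
  by rewrite /L_ lnM ?posrE// addrC addKr.
have L_tau : L_ k <= L_ k `^ tau.
  by rewrite le1r_powR// ltW.
have Lt1 : 1 <= L_ k `^ tau := le_trans L1 L_tau.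
pose K := C * (2 + `|ln rho| + b).
have K0 : 0 < K by rewrite /K mulr_gt0// addr_gt0// ltr_wpDr.
have B1 : C * (1 + ln k%:R + s) <= K * L_ k `^ tau.
  rewrite /K -mulrA ler_pM2l// lk.
  have := lerNnormlW (lexx `|ln rho|).
  have : `|ln rho| <= `|ln rho| * L_ k `^ tau by rewrite ler_peMr.
  lra.
have B2 : K * L_ k `^ tau <= expR (e / 3 * L_ k `^ (tau - 1)).
  have KL : 0 < K * L_ k `^ tau by rewrite mulr_gt0// powR_gt0.
  rewrite -[leLHS]lnK ?posrE// ler_expR lnM ?posrE ?powR_gt0// ln_powR.
  by near: k; exact: near_Lln.
apply: le_trans (ler_wpM2r (expR_ge0 _) (le_trans B1 B2)) _.
rewrite -expRD ler_expR /s.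
by rewrite le_eqVlt; apply/orP; left; apply/eqP; field.
Unshelve. all: by end_near. Qed.

(** The Laplace lower bound at the minimiser [ln z = L - w], where
    [exp w = log_slope L / c].  As [w] is of the order of [ln L], the second
    order term [w ^+ 2 / L] of [powR_bernoulli_le] tends to 0. *)
Lemma log_lower (q : nat -> R) (H : R -> R) :
  laplace_lower q (c * rho) H ->
  (forall e, 0 < e -> \forall z \near +oo,
     expR (- (b * ln z `^ tau + e * ln z `^ (tau - 1))) <= H z) ->
  forall e, 0 < e -> \forall k \near \oo,
    expR (- (log_rate (L_ k) + e * L_ k `^ (tau - 1))) <= q k.
Proof.
move=> qH HH e e0.
have e40 : 0 < e / 4 by rewrite divr_gt0.
pose e' := e / (4 * (b * tau)).
have e'0 : 0 < e' by rewrite divr_gt0// mulr_gt0.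
have [Z1 [_ HZ1]] := HH _ e40.
have [C [Z [C0 Z0 low]]] := qH e' e'0.
have e'E L : e' * log_slope L = e / 4 * L `^ (tau - 1).
  by rewrite /e' /log_slope; field; rewrite !gt_eqF.
(* The second order term is [b * tau ^+ 2 * (w ^+ 2 / L) * L `^ (tau - 1)]. *)
pose nu := e / (4 * (b * tau ^+ 2)).
have nu0 : 0 < nu by rewrite divr_gt0// !mulr_gt0// exprn_gt0.
have snu0 : 0 < Num.sqrt nu by rewrite sqrtr_gt0.
near=> k.
have k0 : (0 < k)%N by near: k; exists 1%N.
have kR : 0 < k%:R :> R by rewrite ltr0n.
have rk : 0 < rho * k%:R by rewrite mulr_gt0.
have L1 : 1 <= L_ k by near: k; exact: (near_L (near_pinfty_ge _)).
have L0 : 0 < L_ k := lt_le_trans ltr01 L1.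
have P0 : 0 < L_ k `^ (tau - 1) by exact: powR_gt0.
have B0 := log_slope_gt0 L0.
pose w := ln (log_slope (L_ k)) - ln c.
have wE : w = ln (b * tau) - ln c + (tau - 1) * ln (L_ k).
  by rewrite /w ln_log_slope//; ring.
have w0 : 0 <= w.
  rewrite wE -lerBlDl sub0r.
  rewrite -ler_pdivrMl//.
  by near: k; exact: (near_L (near_ln_ge _)).
have B1 : 1 <= log_slope (L_ k).
  rewrite -[leLHS]expR0 -[leRHS]lnK ?posrE// ler_expR ln_log_slope// -lerBlDl sub0r.
  rewrite -ler_pdivrMl//.
  by near: k; exact: (near_L (near_ln_ge _)).
have wL : w <= 2^-1 * L_ k.
  by rewrite wE; near: k; apply: near_Lln1.
have w2 : w ^+ 2 / L_ k <= nu.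
  rewrite ler_pdivrMr//.
  have : w <= Num.sqrt nu * L_ k `^ 2^-1.
    by rewrite wE; near: k; apply: near_Lln.
  move=> h; have := lerXn2r 2 _ _ h; rewrite !nnegrE mulr_ge0 ?powR_ge0 ?(ltW snu0)//.
  move=> /(_ w0 isT).
  by rewrite exprMn sqr_sqrtr ?(ltW nu0)// powR12_sqrt ?(ltW L0)// sqr_sqrtr ?(ltW L0).
set z := expR (L_ k - w).
have z0 : 0 < z by exact: expR_gt0.
have zbig : ln (Num.max Z (Num.max 1 (Z1 + 1))) <= L_ k - w.
  rewrite (@le_trans _ _ (2^-1 * L_ k))//; last by lra.
  rewrite -ler_pdivrMl//.
  by near: k; exact: (near_L (near_pinfty_ge _)).
have zbig' : Num.max Z (Num.max 1 (Z1 + 1)) <= z.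
  by rewrite -[leLHS]lnK ?posrE ?lt_max ?Z0// ler_expR.
move: zbig'; rewrite !ge_max => /and3P[Zz _ Z1z].
have {}Z1z : Z1 < z by rewrite (lt_le_trans _ Z1z)// ltrDl.
have slopeE : c * rho * k%:R / z = log_slope (L_ k).
  rewrite /z expRB expRB !lnK ?posrE//; field.
  by rewrite !gt_eqF.
have zck : z <= c * rho * k%:R.
  by rewrite -[leLHS]mul1r -ler_pdivlMr// slopeE.
have := low k z Zz zck; rewrite slopeE; apply: le_trans.
have HZ := HZ1 _ Z1z.
apply: le_trans (ler_wpM2l _ HZ); last by rewrite mulr_ge0 ?expR_ge0 ?ltW.
have BC : expR (- (e / 4 * L_ k `^ (tau - 1))) <= C.
  rewrite -[leRHS]lnK ?posrE// ler_expR lerNl.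
  rewrite -[leLHS]addr0 -(mul0r (ln (L_ k))); near: k; exact: near_Lln.
rewrite -[leRHS]mulrA -expRD.
apply: le_trans (ler_wpM2r (expR_ge0 _) BC).
rewrite -expRD ler_expR -!opprD lerN2 expRK mulrDl mul1r e'E.
have wL' : 0 <= w < L_ k by rewrite w0/= (le_lt_trans wL)//; lra.
have h1 := ler_wpM2l (ltW b_gt0) (powR_bernoulli_le L0 wL').
have h2 : (L_ k - w) `^ (tau - 1) <= L_ k `^ (tau - 1).
  have lw0 : 0 <= L_ k - w by rewrite subr_ge0 ltW//; case/andP: wL'.
  apply: ge0_ler_powR; rewrite ?nnegrE ?(ltW taum1_gt0) ?(ltW L0)//.
  by rewrite gerBl.
have h3 := ler_wpM2l (ltW e40) h2.
have h4 : b * tau ^+ 2 * (w ^+ 2 / L_ k) * L_ k `^ (tau - 1) <= e / 4 * L_ k `^ (tau - 1).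
  rewrite ler_pM2r//.
  apply: (@le_trans _ _ (b * tau ^+ 2 * nu)).
    by rewrite ler_pM2l// mulr_gt0// exprn_gt0.
  by rewrite /nu le_eqVlt; apply/orP; left; apply/eqP; field; rewrite !gt_eqF.
have h5 : log_rate (L_ k) = b * L_ k `^ tau + log_slope (L_ k) - b * tau * w * L_ k `^ (tau - 1).
  by rewrite /log_rate /w /log_slope; ring.
rewrite h5; lra.
Unshelve. all: by end_near. Qed.

End log_stretched.

(** * Tails of dominated variation *)

Section dominated_variation.
Context (R : realType) (H : R -> R) (kap : R).
Hypotheses (kap_gt0 : 0 < kap) (H_le1 : forall z : R, H z <= 1)
  (H_noninc : forall y z : R, 0 < y -> y <= z -> H z <= H y)
  (H_gt0 : forall z : R, 0 < z -> 0 < H z)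
  (H_doubling : \forall z \near +oo, kap * H z <= H (2 * z)).

(** Potter's bound: each doubling of the argument divides [H] by at most
    [2 ^+ A], so [H z / H y] grows at most like a power of [y / z].  The first
    factor [2 ^+ A] covers the last, incomplete, doubling. *)
Lemma dominated_variation_le : exists (A : nat) (X : R), 0 < X /\
  forall z y, X <= z -> z <= y -> H z <= 2 ^+ A * (y / z) ^+ A * H y.
Proof.
have [X1 [_ HX1]] := H_doubling.
pose A := (Num.truncn kap^-1).+1.
have kA : kap^-1 <= 2 ^+ A.
  rewrite (@le_trans _ _ A%:R)//; first by rewrite ltW// truncnS_gt.
  by rewrite -natrX ler_nat ltnW// ltn_expl.
exists A, (Num.max 1 (X1 + 1)); split; first by rewrite lt_max ltr01.
have dbl z : Num.max 1 (X1 + 1) <= z -> H z <= 2 ^+ A * H (2 * z).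
  rewrite ge_max => /andP[z1 Xz].
  have Xz' : X1 < z by rewrite (lt_le_trans _ Xz)// ltrDl.
  have h := HX1 _ Xz'.
  apply: (@le_trans _ _ (kap^-1 * H (2 * z))).
    by rewrite ler_pdivlMl.
  have z0 : 0 < z := lt_le_trans ltr01 z1.
  by rewrite ler_wpM2r// ltW// H_gt0 ?mulr_gt0.
have step (n : nat) z y : Num.max 1 (X1 + 1) <= z -> z <= y -> y <= 2 ^+ n * z ->
    H z <= 2 ^+ A * (y / z) ^+ A * H y.
  elim: n z => [|n IH] z Xz zy yz.
    have -> : y = z by apply/le_anti; rewrite zy andbT -[leRHS]mul1r.
    have z0 : 0 < z by apply: lt_le_trans Xz; rewrite lt_max ltr01.
    rewrite divff ?gt_eqF// expr1n mulr1 ler_peMl ?(ltW (H_gt0 z0))//.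
    by rewrite exprn_ege1// ler1n.
  have z0 : 0 < z by apply: lt_le_trans Xz; rewrite lt_max ltr01.
  have z2 : z <= 2 * z by rewrite ler_peMl ?ler1n// ltW.
  apply: (le_trans (dbl z Xz)).
  have [zy2|yz2] := leP (2 * z) y.
    rewrite -mulrA ler_wpM2l ?exprn_ge0//.
    have -> : (y / z) ^+ A = 2 ^+ A * (y / (2 * z)) ^+ A.
      by rewrite -exprMn; congr (_ ^+ _); field; rewrite gt_eqF.
    apply: IH => //; first exact: le_trans z2.
    by rewrite mulrA -exprSr.
  rewrite -mulrA ler_wpM2l ?exprn_ge0//.
  apply: (@le_trans _ _ (H y)); first by apply: H_noninc => //; [exact: lt_le_trans zy|exact: ltW].
  rewrite ler_peMl ?(ltW (H_gt0 (lt_le_trans z0 zy)))// exprn_ege1//.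
  by rewrite ler_pdivlMr// mul1r.
move=> z y Xz zy.
have z0 : 0 < z by apply: lt_le_trans Xz; rewrite lt_max ltr01.
apply: (step (Num.truncn (y / z)).+1) => //.
rewrite -ler_pdivrMr//.
rewrite (@le_trans _ _ (Num.truncn (y / z)).+1%:R)//; first by rewrite ltW// truncnS_gt.
by rewrite -natrX ler_nat ltnW// ltn_expl.
Qed.

Lemma expn_mul_expRN_le (n : nat) (c x : R) : 0 < c -> 0 <= x ->
  x ^+ n * expR (- (c * x)) <= n.+1`!%:R * c^-1 ^+ n.+1 + 1.
Proof.
move=> c0 x0; have cx : 0 <= c * x by rewrite mulr_ge0// ltW.
rewrite expRN ler_pdivrMr ?expR_gt0//.
have D0 : 0 <= n.+1`!%:R * c^-1 ^+ n.+1 :> R.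
  by rewrite mulr_ge0// exprn_ge0// invr_ge0 ltW.
have [x1|x1] := leP x 1.
  apply: (@le_trans _ _ 1); first by rewrite exprn_ile1.
  rewrite -[leLHS]mul1r ler_pM//; first by rewrite lerDr.
  by rewrite -[leLHS]expR0 ler_expR.
have h := expR_ge1Dxn n cx.
rewrite mulrDl mul1r -[leLHS]addr0 lerD ?expR_ge0//.
apply: (@le_trans _ _ (x ^+ n.+1)); first by rewrite ler_weXn2l// ltW.
apply: (@le_trans _ _ (n.+1`!%:R * c^-1 ^+ n.+1 * ((c * x) ^+ n.+1 / n.+1`!%:R))).
  rewrite exprMn exprVn le_eqVlt; apply/orP; left; apply/eqP; field.
  by rewrite pnatr_eq0 -lt0n fact_gt0 gt_eqF ?exprn_gt0.
rewrite ler_wpM2l//; apply: le_trans h.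
by rewrite lerDr.
Qed.

(** By Potter's bound [exp (- c k / (2 z)) * H z] is at most a constant
    multiple [E] of [H k].  The exponent [s] is [- ln E] unless [E > 1], in
    which case [s = 0] does; it is at most logarithmic in [k], again by
    Potter's bound. *)
Lemma dominated_upper (q : nat -> R) (c : R) : 0 < c -> laplace_upper q c H ->
  exists2 C, 0 < C & \forall k \near \oo, q k <= C * (1 + ln k%:R) * H k%:R.
Proof.
move=> c0 qH.
have [A [X [X0 HX]]] := dominated_variation_le.
have e01 : 0 < (2^-1 : R) < 1.
  by apply/andP; split; [rewrite invr_gt0|rewrite invf_lt1 ?ltr1n].
have [C [eta [C0 eta0 up]]] := qH _ X e01 X0.
pose D : R := A.+1`!%:R * (2^-1 * c)^-1 ^+ A.+1 + 1.
have D1 : 1 <= D.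
  by rewrite /D lerDr mulr_ge0// exprn_ge0// invr_ge0 mulr_ge0// ltW.
pose D' := 2 ^+ A * D.
have A1 : 1 <= 2 ^+ A :> R by rewrite exprn_ege1// ler1n.
have D'1 : 1 <= D' by rewrite -[leLHS]mul1r ler_pM.
have D'0 : 0 < D' := lt_le_trans ltr01 D'1.
have HX0 : 0 < H X by exact: H_gt0.
pose K := 1 + A%:R + `|ln (2 ^+ A) - ln (H X) - A%:R * ln X|.
exists (C * (D' * K)).
  by rewrite mulr_gt0// mulr_gt0// /K ltr_wpDr// ltr_wpDr.
near=> k.
have k0 : (0 < k)%N by near: k; exists 1%N.
have kR : 0 < k%:R :> R by rewrite ltr0n.
have k1 : 1 <= k%:R :> R by rewrite ler1n.
have Xk : X <= k%:R by near: k; exact: (near_natr (near_pinfty_ge X)).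
have Hk0 : 0 < H k%:R by exact: H_gt0.
set E := D' * H k%:R.
have E0 : 0 < E by rewrite mulr_gt0.
set s := Num.max 0 (- ln E).
have lnk0 : 0 <= ln (k%:R : R) by rewrite ln_ge0.
have s_le : s <= `|ln (2 ^+ A) - ln (H X) - A%:R * ln X| + A%:R * ln k%:R.
  rewrite ge_max; apply/andP; split; first by rewrite addr_ge0// mulr_ge0.
  rewrite lerNl -[leRHS]opprK lerN2 lerNl.
  have h := HX X k%:R (lexx _) Xk.
  have : ln (H X) <= ln (2 ^+ A * (k%:R / X) ^+ A * H k%:R).
    by rewrite ler_ln ?posrE// !mulr_gt0// exprn_gt0// divr_gt0.
  have dX : 0 < (k%:R / X) ^+ A by rewrite exprn_gt0// divr_gt0.
  have A0 : 0 < 2 ^+ A :> R by rewrite exprn_gt0.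
  rewrite lnM ?posrE ?mulr_gt0// lnM ?posrE//.
  rewrite (lnXn A (divr_gt0 kR X0)) ln_div ?posrE// -[_ *+ A]mulr_natl.
  have : ln (H k%:R) <= ln E.
    by rewrite ler_ln ?posrE// /E ler_peMl// ltW.
  have := ler_norm (ln (2 ^+ A) - ln (H X) - A%:R * ln X).
  lra.
have s0 : 0 <= s <= eta * k%:R.
  rewrite le_max lexx/= (le_trans s_le)//.
  near: k; apply: (near_natr (Q := fun y => _ + _ * ln y <= eta * y)).
  near=> y; have y0 : 0 <= y by near: y; exact: near_pinfty_ge.
  rewrite -[X in eta * X]powRr1//; near: y; exact: near_ln_le_powR.
have Es : expR (- s) <= E.
  rewrite -[leRHS]lnK ?posrE// ler_expR lerNl le_max lexx orbT//.
have sE : E <= expR (- s) \/ s = 0.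
  rewrite /s; case: (leP 0 (- ln E)) => h; [left|right] => //.
  by rewrite opprK lnK ?posrE.
have := up k s k0 s0 => /(_ _)/le_trans; apply.
  move=> z Xz.
  have z0 : 0 < z := lt_le_trans X0 Xz.
  have ex1 : expR (- ((1 - 2^-1) * (c * k%:R / z))) <= 1.
    have h0 : 0 <= 1 - 2^-1 :> R by rewrite subr_ge0; case/andP: e01 => _ /ltW.
    by rewrite expR_le1 oppr_le0 mulr_ge0// divr_ge0 ?mulr_ge0 ?(ltW c0) ?(ltW z0).
  case: sE => [sE|->]; last first.
    by rewrite oppr0 expR0 mulr_ile1 ?expR_ge0 ?(ltW (H_gt0 z0)).
  apply: le_trans sE; rewrite /E.
  have [zk|kz] := leP z k%:R; last first.
    apply: ler_pM; rewrite ?expR_ge0 ?(ltW (H_gt0 z0))//; first exact: le_trans D'1.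
    by apply: H_noninc => //; exact: ltW.
  apply: le_trans (ler_wpM2l (expR_ge0 _) (HX z k%:R Xz zk)) _.
  rewrite mulrA ler_pM2r// mulrCA /D' ler_pM2l; last by rewrite exprn_gt0.
  rewrite mulrC (_ : (1 - 2^-1) * _ = 2^-1 * c * (k%:R / z)); last first.
    by field; rewrite gt_eqF.
  apply: expn_mul_expRN_le; first by rewrite mulr_gt0// invr_gt0.
  by rewrite divr_ge0// ltW.
have -> : C * (D' * K) * (1 + ln k%:R) * H k%:R = C * (K * (1 + ln k%:R) * E).
  by rewrite /E; ring.
rewrite -mulrA ler_pM2l//.
apply: ler_pM => //; rewrite ?expR_ge0//.
  by rewrite !addr_ge0//; case/andP: s0.
rewrite /K; move: s_le.
have := normr_ge0 (ln (2 ^+ A) - ln (H X) - A%:R * ln X).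
move: `|_| => N N0 s_le.
have : 0 <= N * ln k%:R by rewrite mulr_ge0.
have : 0 <= A%:R :> R by [].
lra.
Unshelve. all: by end_near. Qed.

Lemma dominated_lower (q : nat -> R) (c : R) : 0 < c <= 1 -> laplace_lower q c H ->
  exists2 C, 0 < C & \forall k \near \oo, C * H k%:R <= q k.
Proof.
move=> /andP[c0 c1] qH; have [C [Z [C0 Z0 low]]] := qH 1 ltr01.
exists (C * expR (- 2)); first by rewrite mulr_gt0 ?expR_gt0.
near=> k.
have k0 : 0 < k%:R :> R by rewrite ltr0n; near: k; exists 1%N.
have Zk : Z <= c * k%:R.
  by near: k; exact: (cvg_mul_natr_pinfty c0 (near_pinfty_ge Z)).
apply: le_trans (low k _ Zk (lexx _)).
rewrite divff ?mulr1 ?gt_eqF ?mulr_gt0//.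
rewrite ler_pM2l ?mulr_gt0 ?expR_gt0//.
by apply: H_noninc; [rewrite mulr_gt0|rewrite ler_piMl// ltW].
Unshelve. all: by end_near. Qed.

End dominated_variation.

(** * Tails given up to asymptotic equivalence *)

Section tail_hypotheses.
Context (R : realType).
Implicit Types (G F : R -> R).

Lemma powR2_gt1 (s : R) : 0 < s -> 1 < 2 `^ s :> R.
Proof.
move=> s0; suff : 1 `^ s < 2 `^ s :> R by rewrite powR1.
by apply: gt0_ltr_powR; rewrite ?nnegrE// ltr1n.
Qed.

Lemma asymp_equiv_bounds G F : asymp_equiv G F ->
  (\forall x \near +oo, 0 < F x) ->
  \forall x \near +oo, F x / 2 <= G x <= 2 * F x.
Proof.
move=> GF F0; near=> x.
have Fx : 0 < F x by near: x.
have : `|1 - G x / F x| <= 2^-1.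
  near: x; move/cvgrPdist_le : GF; apply.
  by rewrite invr_gt0.
rewrite ler_distlC => /andP[h1 h2].
apply/andP; split.
  rewrite -[F x / 2]mulrC -ler_pdivlMr// (le_trans _ h1)//; lra.
rewrite -ler_pdivrMr// (le_trans h2)//; lra.
Unshelve. all: by end_near. Qed.

(** Any prefactor [a * y `^ b], even with the constants of a two-sided bound, is
    negligible against an exponential of a power. *)
Lemma near_prefactor (a b e s : R) : 0 < a -> 0 < e -> 0 < s ->
  \forall y \near +oo, 2 * (a * (y : R) `^ b) <= expR (e * y `^ s) /\
    expR (- (e * y `^ s)) <= a * y `^ b / 2.
Proof.
move=> a0 e0 s0; near=> y.
have y0 : 0 < y by near: y; exact: near_pinfty_gt.
have yb : 0 < y `^ b by exact: powR_gt0.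
split.
  rewrite mulrA -[leLHS]lnK ?posrE ?mulr_gt0// ler_expR lnM ?posrE ?mulr_gt0//.
  by rewrite ln_powR; near: y; exact: near_ln_le_powR.
rewrite mulrAC -[leRHS]lnK ?posrE ?mulr_gt0 ?divr_gt0// ler_expR.
rewrite lnM ?posrE ?divr_gt0// ln_powR lerNl opprD -mulNr.
near: y; exact: near_ln_le_powR.
Unshelve. all: by end_near. Qed.

Lemma near_mul2 (Q : R -> Prop) : (\forall z \near +oo, Q z) ->
  \forall z \near +oo, Q (2 * z).
Proof.
move=> [M [_ HM]]; near=> z; apply: HM.
rewrite -ltr_pdivrMl//; near: z; exact: near_pinfty_gt.
Unshelve. all: by end_near. Qed.

Section stretched.
Variables (a c1 tau b : R) (G : R -> R).
Hypotheses (a0 : 0 < a) (c10 : 0 < c1) (tau0 : 0 < tau).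
Hypothesis GE : asymp_equiv G (fun x => a * x `^ b * expR (- (x / c1) `^ tau)).

Let bounds : \forall x \near +oo,
  a * x `^ b * expR (- (x / c1) `^ tau) / 2 <= G x
    <= 2 * (a * x `^ b * expR (- (x / c1) `^ tau)).
Proof.
apply: (asymp_equiv_bounds GE); near=> x.
have x0 : 0 < x by near: x; exact: near_pinfty_gt.
by rewrite mulr_gt0 ?expR_gt0// mulr_gt0// powR_gt0.
Unshelve. all: by end_near. Qed.

Let scale z : 0 < z -> (z / c1) `^ tau = c1^-1 `^ tau * z `^ tau.
Proof. by move=> z0; rewrite powRM ?invr_ge0 ?(ltW z0) ?(ltW c10)// mulrC. Qed.

Let K0 : 0 < c1^-1 `^ tau. Proof. by rewrite powR_gt0// invr_gt0. Qed.

Lemma stretched_tail_le e : 0 < e -> \forall z \near +oo,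
  G z <= expR (- ((1 - e) * (z / c1) `^ tau)).
Proof.
move=> e0; near=> z.
have z0 : 0 < z by near: z; exact: near_pinfty_gt.
have /andP[_ Gz] : a * z `^ b * expR (- (z / c1) `^ tau) / 2 <= G z
    <= 2 * (a * z `^ b * expR (- (z / c1) `^ tau)) by near: z.
have [P1 _] : 2 * (a * z `^ b) <= expR (e * c1^-1 `^ tau * z `^ tau) /\
    expR (- (e * c1^-1 `^ tau * z `^ tau)) <= a * z `^ b / 2.
  by near: z; apply: near_prefactor => //; rewrite mulr_gt0.
apply: (le_trans Gz); rewrite mulrA.
apply: le_trans (ler_wpM2r (expR_ge0 _) P1) _.
rewrite -expRD ler_expR scale//.
by rewrite le_eqVlt; apply/orP; left; apply/eqP; ring.
Unshelve. all: by end_near. Qed.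

Lemma stretched_tail_ge e : 0 < e -> \forall z \near +oo,
  expR (- ((1 + e) * (z / c1) `^ tau)) <= G z.
Proof.
move=> e0; near=> z.
have z0 : 0 < z by near: z; exact: near_pinfty_gt.
have /andP[Gz _] : a * z `^ b * expR (- (z / c1) `^ tau) / 2 <= G z
    <= 2 * (a * z `^ b * expR (- (z / c1) `^ tau)) by near: z.
have [_ P1] : 2 * (a * z `^ b) <= expR (e * c1^-1 `^ tau * z `^ tau) /\
    expR (- (e * c1^-1 `^ tau * z `^ tau)) <= a * z `^ b / 2.
  by near: z; apply: near_prefactor => //; rewrite mulr_gt0.
apply: le_trans Gz; rewrite mulrAC.
apply: le_trans (ler_wpM2r (expR_ge0 _) P1).
rewrite -expRD ler_expR scale//.
by rewrite le_eqVlt; apply/orP; left; apply/eqP; ring.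
Unshelve. all: by end_near. Qed.

(** Doubling [z] multiplies the exponent by [2 `^ tau > 1]; the error [e] in the
    exponents is chosen so that half of the gain [2 `^ tau - 1] is left. *)
Lemma stretched_tail_doubling : \forall z \near +oo, G (2 * z) <= 2^-1 * G z.
Proof.
have t1 := powR2_gt1 tau0.
pose e := (2 `^ tau - 1) / (2 * (2 `^ tau + 1)).
have tp : 0 < 2 `^ tau + 1 :> R by rewrite addr_gt0// powR_gt0.
have tm : 0 < 2 `^ tau - 1 :> R by rewrite subr_gt0.
have e0 : 0 < e by rewrite divr_gt0// mulr_gt0.
near=> z.
have z0 : 0 < z by near: z; exact: near_pinfty_gt.
have h1 : G (2 * z) <= expR (- ((1 - e) * ((2 * z) / c1) `^ tau)).
  by near: z; exact: (near_mul2 (stretched_tail_le e0)).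
have h2 : expR (- ((1 + e) * (z / c1) `^ tau)) <= G z.
  by near: z; exact: stretched_tail_ge.
apply: (le_trans h1); apply: le_trans (ler_wpM2l _ h2); last by rewrite invr_ge0.
rewrite -[X in X * expR _]lnK ?posrE ?invr_gt0// -expRD ler_expR lnV ?posrE//.
rewrite !scale ?mulr_gt0// powRM ?(ltW z0)//.
have h3 : ln 2 <= (2 `^ tau - 1) / 2 * c1^-1 `^ tau * z `^ tau.
  rewrite -ler_pdivrMl; last by rewrite mulr_gt0// divr_gt0.
  by near: z; exact: near_le_powR.
rewrite -opprD lerN2.
rewrite (_ : (1 - e) * _ = (1 + e) * (c1^-1 `^ tau * z `^ tau) +
    (2 `^ tau - 1) / 2 * c1^-1 `^ tau * z `^ tau); last first.
  by rewrite /e; field; rewrite gt_eqF.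
by rewrite addrC lerD2l.
Unshelve. all: by end_near. Qed.

End stretched.

Section log_stretched_tail.
Variables (a c1 b tau : R) (G : R -> R).
Hypotheses (a0 : 0 < a) (c10 : 0 < c1) (tau1 : 1 < tau).
Hypothesis GE : asymp_equiv G (fun x => a * (ln x) `^ b * expR (- (ln x / c1) `^ tau)).

Let K := c1^-1 `^ tau.
Let K0 : 0 < K. Proof. by rewrite powR_gt0// invr_gt0. Qed.
Let taum1 : 0 < tau - 1. Proof. by rewrite subr_gt0. Qed.

Let near_ln (Q : R -> Prop) : (\forall y \near +oo, Q y) ->
  \forall z \near +oo, Q (ln z).
Proof. by move=> HQ; exact: (@cvg_ln_pinfty R _ HQ). Qed.

Let bounds : \forall x \near +oo,
  a * (ln x) `^ b * expR (- (ln x / c1) `^ tau) / 2 <= G x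
    <= 2 * (a * (ln x) `^ b * expR (- (ln x / c1) `^ tau)).
Proof.
apply: (asymp_equiv_bounds GE); near=> x.
have x0 : 0 < ln x by near: x; exact: (near_ln (near_pinfty_gt _)).
by rewrite mulr_gt0 ?expR_gt0// mulr_gt0// powR_gt0.
Unshelve. all: by end_near. Qed.

Let scale z : 0 < z -> (z / c1) `^ tau = K * z `^ tau.
Proof. by move=> z0; rewrite powRM ?invr_ge0 ?(ltW z0) ?(ltW c10)// mulrC. Qed.

Lemma log_tail_le e : 0 < e -> \forall z \near +oo,
  G z <= expR (- (K * ln z `^ tau - e * ln z `^ (tau - 1))).
Proof.
move=> e0; near=> z.
have z0 : 0 < ln z by near: z; exact: (near_ln (near_pinfty_gt _)).
have /andP[_ Gz] : a * ln z `^ b * expR (- (ln z / c1) `^ tau) / 2 <= G z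
    <= 2 * (a * ln z `^ b * expR (- (ln z / c1) `^ tau)) by near: z.
have [P1 _] : 2 * (a * ln z `^ b) <= expR (e * ln z `^ (tau - 1)) /\
    expR (- (e * ln z `^ (tau - 1))) <= a * ln z `^ b / 2.
  by near: z; exact: (near_ln (near_prefactor _ _ _ _)).
apply: (le_trans Gz); rewrite mulrA.
apply: le_trans (ler_wpM2r (expR_ge0 _) P1) _.
by rewrite -expRD ler_expR scale// opprB.
Unshelve. all: by end_near. Qed.

Lemma log_tail_ge e : 0 < e -> \forall z \near +oo,
  expR (- (K * ln z `^ tau + e * ln z `^ (tau - 1))) <= G z.
Proof.
move=> e0; near=> z.
have z0 : 0 < ln z by near: z; exact: (near_ln (near_pinfty_gt _)).
have /andP[Gz _] : a * ln z `^ b * expR (- (ln z / c1) `^ tau) / 2 <= G z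
    <= 2 * (a * ln z `^ b * expR (- (ln z / c1) `^ tau)) by near: z.
have [_ P1] : 2 * (a * ln z `^ b) <= expR (e * ln z `^ (tau - 1)) /\
    expR (- (e * ln z `^ (tau - 1))) <= a * ln z `^ b / 2.
  by near: z; exact: (near_ln (near_prefactor _ _ _ _)).
apply: le_trans Gz; rewrite mulrAC.
apply: le_trans (ler_wpM2r (expR_ge0 _) P1).
by rewrite -expRD ler_expR scale// opprD addrC.
Unshelve. all: by end_near. Qed.

(** Doubling [z] adds at least [K * tau * ln 2 * (ln z) `^ (tau - 1)] to the
    exponent, which tends to infinity because [tau > 1]; half of it pays for
    the error terms. *)
Lemma log_tail_doubling : \forall z \near +oo, G (2 * z) <= 2^-1 * G z.
Proof.
have tp : 0 < 1 + 2 `^ (tau - 1) :> R by rewrite addr_gt0// powR_gt0.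
have l20 : 0 < ln 2 :> R by rewrite ln_gt0// ltr1n.
have tau0 : 0 < tau := lt_trans ltr01 tau1.
pose e := K * tau * ln 2 / (2 * (1 + 2 `^ (tau - 1))).
have e0 : 0 < e by rewrite divr_gt0 ?mulr_gt0.
near=> z.
have z0 : 0 < z by near: z; exact: near_pinfty_gt.
have lz0 : 0 < ln z by near: z; exact: (near_ln (near_pinfty_gt _)).
have lz2 : ln 2 <= ln z by near: z; exact: (near_ln (near_pinfty_ge _)).
have h1 : G (2 * z) <=
    expR (- (K * ln (2 * z) `^ tau - e * ln (2 * z) `^ (tau - 1))).
  by near: z; exact: (near_mul2 (log_tail_le e0)).
have h2 : expR (- (K * ln z `^ tau + e * ln z `^ (tau - 1))) <= G z.
  by near: z; exact: log_tail_ge.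
apply: (le_trans h1); apply: le_trans (ler_wpM2l _ h2); last by rewrite invr_ge0.
rewrite -[X in X * expR _]lnK ?posrE ?invr_gt0// -expRD ler_expR lnV ?posrE//.
rewrite -opprD lerN2 lnM ?posrE//.
have h6 : ln 2 <= K * tau * ln 2 / 2 * ln z `^ (tau - 1).
  rewrite -ler_pdivrMl; last by rewrite divr_gt0 ?mulr_gt0.
  by near: z; exact: (near_ln (near_le_powR _ taum1)).
set l := ln z in lz0 lz2 h6 *.
have l2 : 0 < ln 2 + l by rewrite addr_gt0.
have h3 := ler_wpM2l (ltW K0) (powR_bernoulli_ge tau1 l2 lz0).
have h4 : (ln 2 + l) `^ (tau - 1) <= 2 `^ (tau - 1) * l `^ (tau - 1).
  rewrite -powRM ?(ltW lz0)//; apply: ge0_ler_powR; rewrite ?nnegrE ?(ltW taum1) ?(ltW l2)//.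
    by rewrite mulr_ge0// ltW.
  by rewrite mulrDl mul1r lerD2r.
have h5 := ler_wpM2l (ltW e0) h4.
have eE : e * (2 `^ (tau - 1) * l `^ (tau - 1)) =
    K * tau * ln 2 / 2 * l `^ (tau - 1) - e * l `^ (tau - 1).
  by rewrite /e; field; rewrite gt_eqF.
move: h3 h5; rewrite eE addrK => h3 h5.
lra.
Unshelve. all: by end_near. Qed.

End log_stretched_tail.

Section regular_variation.
Variables (a : R) (l H : R -> R).
Hypotheses (H_ge0 : forall z : R, 0 < z -> 0 <= H z)
  (H_noninc : forall y z : R, 0 < y -> y <= z -> H z <= H y)
  (sl : slowly_varying l)
  (HE : forall x : R, 0 < x -> H x = l x * x `^ (- a)).

Let l_ge0 x : 0 < x -> 0 <= l x.
Proof.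
by move=> x0; have := H_ge0 x0; rewrite HE// pmulr_lge0// powR_gt0.
Qed.

Let near_ratio (e : R) : 0 < e -> \forall z \near +oo, `|1 - l (2 * z) / l z| <= e.
Proof. by move=> e0; have /cvgrPdist_le := sl (ltr0n R 2); apply. Qed.

(** Where [l z = 0] the ratio [l (2 z) / l z] is 0 by the convention on
    division, which is far from its limit 1. *)
Lemma slowly_varying_gt0 : \forall z \near +oo, 0 < l z.
Proof.
near=> z; have z0 : 0 < z by near: z; exact: near_pinfty_gt.
rewrite lt_neqAle l_ge0// andbT eq_sym; apply/eqP => lz.
have : `|1 - l (2 * z) / l z| <= 2^-1 by near: z; apply: near_ratio; rewrite invr_gt0.
by rewrite lz invr0 mulr0 subr0 normr1 invf_ge1// lern1.
Unshelve. all: by end_near. Qed.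

Lemma regularly_varying_gt0 z : 0 < z -> 0 < H z.
Proof.
move=> z0; have [M [_ HM]] := slowly_varying_gt0.
pose y := Num.max z (M + 1).
have My : M < y by rewrite lt_max ltrDl ltr01 orbT.
have zy : z <= y by rewrite le_max lexx.
have y0 : 0 < y := lt_le_trans z0 zy.
apply: lt_le_trans (H_noninc z0 zy).
by rewrite HE// mulr_gt0 ?powR_gt0// HM.
Qed.

Lemma regularly_varying_doubling_ge :
  \forall z \near +oo, 2^-1 * 2 `^ (- a) * H z <= H (2 * z).
Proof.
near=> z; have z0 : 0 < z by near: z; exact: near_pinfty_gt.
have lz : 0 < l z by near: z; exact: slowly_varying_gt0.
have : `|1 - l (2 * z) / l z| <= 2^-1 by near: z; apply: near_ratio; rewrite invr_gt0.
rewrite ler_distlC => /andP[h _].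
rewrite !HE ?mulr_gt0// powRM ?(ltW z0)//.
have {}h : 2^-1 * l z <= l (2 * z).
  by rewrite -ler_pdivlMr// (le_trans _ h)//; lra.
have p0 : 0 <= 2 `^ (- a) * z `^ (- a) by rewrite mulr_ge0 ?powR_ge0.
have := ler_wpM2r p0 h; lra.
Unshelve. all: by end_near. Qed.

(** The ratio [H (2 z) / H z] tends to [2 `^ (- a) < 1]; the midpoint between this
    limit and 1 is an eventual bound. *)
Lemma regularly_varying_doubling_le : 0 < a ->
  exists2 rho, rho < 1 & \forall z \near +oo, H (2 * z) <= rho * H z.
Proof.
move=> a0; have t1 : 2 `^ (- a) < 1 :> R.
  by rewrite powRN invf_lt1 ?powR_gt0// powR2_gt1.
have t0 : 0 < 2 `^ (- a) :> R by exact: powR_gt0.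
exists ((1 + 2 `^ (- a)) / 2); first by lra.
pose e : R := ((2 `^ (- a))^-1 - 1) / 2.
have e0 : 0 < e by rewrite divr_gt0// subr_gt0 invf_gt1.
near=> z; have z0 : 0 < z by near: z; exact: near_pinfty_gt.
have lz : 0 < l z by near: z; exact: slowly_varying_gt0.
have : `|1 - l (2 * z) / l z| <= e by near: z; exact: near_ratio.
rewrite ler_distlC => /andP[_ h].
rewrite !HE ?mulr_gt0// powRM ?(ltW z0)//.
have {}h : l (2 * z) <= (1 + e) * l z by rewrite -ler_pdivrMr.
have p0 : 0 <= 2 `^ (- a) * z `^ (- a) by rewrite mulr_ge0 ?powR_ge0.
apply: le_trans (ler_wpM2r p0 h) _.
rewrite /e le_eqVlt; apply/orP; left; apply/eqP; field.
by rewrite gt_eqF.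
Unshelve. all: by end_near. Qed.

End regular_variation.
End tail_hypotheses.

(** * Error terms and slowly varying functions *)

Section conclusions.
Context (R : realType).

(** Two-sided bounds with an arbitrary [e] in place of the error are the same as
    an equality with an error tending to 0: the error is obtained by solving
    for it. *)
Lemma o1_witness (f g : nat -> R) (q : nat -> R) :
  (\forall k \near \oo, 0 < g k) ->
  (forall e, 0 < e -> \forall k \near \oo,
     expR (- (f k + e * g k)) <= q k <= expR (- (f k - e * g k))) ->
  exists eps : nat -> R, eps k @[k --> \oo] --> (0 : R) /\
    \forall k \near \oo, q k = expR (- (f k + eps k * g k)).
Proof.
move=> g0 H; exists (fun k => (- ln (q k) - f k) / g k); split.
  apply/cvgrPdist_le => e e0; near=> k.
  have gk : 0 < g k by near: k.
  have /andP[h1 h2] : expR (- (f k + e * g k)) <= q k <= expR (- (f k - e * g k)).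
    by near: k; exact: H.
  have q0 : 0 < q k := lt_le_trans (expR_gt0 _) h1.
  rewrite sub0r normrN ler_norml.
  move: h1 h2; rewrite -[q k]lnK ?posrE// !ler_expR lnK ?posrE// => h1 h2.
  apply/andP; split.
    by rewrite ler_pdivlMr//; lra.
  by rewrite ler_pdivrMr//; lra.
near=> k.
have gk : 0 < g k by near: k.
have /andP[h1 _] : expR (- (f k + 1 * g k)) <= q k <= expR (- (f k - 1 * g k)).
  by near: k; exact: H.
have q0 : 0 < q k := lt_le_trans (expR_gt0 _) h1.
by rewrite divfK ?gt_eqF// addrC subrK opprK lnK.
Unshelve. all: by end_near. Qed.

Section stretched.
Variables (c1 tau c : R) (H : R -> R) (q : nat -> R).
Hypotheses (c10 : 0 < c1) (tau0 : 0 < tau) (c0 : 0 < c).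
Hypotheses (qlow : laplace_lower q c H) (qup : laplace_upper q c H).
Hypotheses
  (Hle : forall e, 0 < e -> \forall z \near +oo,
     H z <= expR (- ((1 - e) * (z / c1) `^ tau)))
  (Hge : forall e, 0 < e -> \forall z \near +oo,
     expR (- ((1 + e) * (z / c1) `^ tau)) <= H z).

Let A (k : nat) : R := stretched_rate c1 tau (c * k%:R).

Lemma stretched_asymp : exists eps : nat -> R, eps k @[k --> \oo] --> (0 : R) /\
  \forall k \near \oo, q k = expR (- ((1 + eps k) * A k)).
Proof.
have [|e e0|eps [eps0 E]] := @o1_witness A A q.
- have h := @near_rate_ln R c1 tau c10 tau0 c 1 0 1 c0 ltr01.
  near=> k; have : 1 + 0 * ln k%:R <= 1 * A k by near: k.
  by rewrite mul0r addr0 mul1r; exact: lt_le_trans.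
- have h2 : 0 < Num.min e 2^-1 < 1.
    by rewrite lt_min e0 invr_gt0 ltr0n/= gt_min invf_lt1// ltr1n orbT.
  have h := @near_rate_ln R c1 tau c10 tau0 c 0 0 1 c0 ltr01.
  have low := stretched_lower c10 tau0 c0 qlow Hge e0.
  have up := stretched_upper c10 tau0 c0 qup Hle h2.
  near=> k.
  have A0 : 0 <= A k.
    have : 0 + 0 * ln k%:R <= 1 * A k by near: k.
    by rewrite mul0r addr0 mul1r.
  apply/andP; split.
    have : expR (- ((1 + e) * A k)) <= q k by near: k.
    by rewrite mulrDl mul1r.
  have : q k <= expR (- ((1 - Num.min e 2^-1) * A k)) by near: k.
  move=> /le_trans; apply; rewrite ler_expR lerN2 mulrBl mul1r lerD2l lerN2.
  by rewrite ler_wpM2r// ge_min lexx.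
- exists eps; split => //; near=> k.
  rewrite mulrDl mul1r; near: k; exact: E.
Unshelve. all: by end_near. Qed.

End stretched.

Section log_stretched.
Variables (c1 tau c rho : R) (H : R -> R) (q : nat -> R).
Hypotheses (c10 : 0 < c1) (tau1 : 1 < tau) (c0 : 0 < c) (rho0 : 0 < rho).
Hypotheses (qlow : laplace_lower q (c * rho) H) (qup : laplace_upper q (c * rho) H).
Let b := c1^-1 `^ tau.
Hypotheses
  (Hle : forall e, 0 < e -> \forall z \near +oo,
     H z <= expR (- (b * ln z `^ tau - e * ln z `^ (tau - 1))))
  (Hge : forall e, 0 < e -> \forall z \near +oo,
     expR (- (b * ln z `^ tau + e * ln z `^ (tau - 1))) <= H z).

Let L (k : nat) : R := ln (rho * k%:R).
Let b0 : 0 < b. Proof. by rewrite powR_gt0// invr_gt0. Qed.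
Let tau0 : 0 < tau := lt_trans ltr01 tau1.

Let near_L_gt0 : \forall k \near \oo, 0 < L k.
Proof. exact: (cvg_mul_natr_pinfty rho0 (cvg_ln_pinfty (near_pinfty_gt 0))). Qed.

Lemma log_stretched_asymp : exists eps : nat -> R, eps k @[k --> \oo] --> (0 : R) /\
  \forall k \near \oo, q k = expR (- ((L k / c1) `^ tau *
    (1 - tau * (tau - 1) * (ln (L k) / L k)
       + (tau * ln (expR 1 * c1 `^ tau * c / tau) + eps k) / L k))).
Proof.
have [|e e0|eps [eps0 E]] := @o1_witness
    (fun k => log_rate b tau c (L k)) (fun k => L k `^ (tau - 1)) q.
- near=> k; apply: powR_gt0; near: k; exact: near_L_gt0.
- near=> k; apply/andP; split; near: k.
    exact: (log_lower b0 tau1 c0 rho0 qlow Hge e0).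
  exact: (log_upper b0 tau1 c0 rho0 qup Hle e0).
exists (fun k => eps k / b); split.
  by rewrite -(mul0r b^-1); apply: cvgMl.
near=> k.
have L0 : 0 < L k by near: k; exact: near_L_gt0.
have -> : q k = expR (- (log_rate b tau c (L k) + eps k * L k `^ (tau - 1))).
  by near: k; exact: E.
congr (expR (- _)).
have -> : (L k / c1) `^ tau = b * (L k * L k `^ (tau - 1)).
  by rewrite powRM ?invr_ge0 ?(ltW L0) ?(ltW c10)// mulrC -powR_pred.
have -> : ln (expR 1 * c1 `^ tau * c / tau) = 1 + ln c - ln (b * tau).
  have ct : 0 < c1 `^ tau by exact: powR_gt0.
  have bE : b = (c1 `^ tau)^-1.
    by apply: (@mulIf _ (c1 `^ tau)); rewrite ?gt_eqF// mulVf ?gt_eqF//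
      -powRM ?invr_ge0 ?(ltW c10)// mulVf ?gt_eqF// powR1.
  rewrite bE ln_div ?posrE ?mulr_gt0 ?expR_gt0// !lnM ?posrE ?mulr_gt0 ?expR_gt0 ?invr_gt0//.
  by rewrite expRK lnV ?posrE//; ring.
rewrite /log_rate ln_log_slope// /log_slope (powR_pred tau L0).
by field; rewrite !gt_eqF.
Unshelve. all: by end_near. Qed.

End log_stretched.

(** The finitely many exceptions are covered by the sum of their ratios. *)
Lemma near_to_all (u v : nat -> R) (C : R) :
  (forall k, (0 < k)%N -> 0 <= u k) -> (forall k, (0 < k)%N -> 0 < v k) ->
  0 < C -> (\forall k \near \oo, u k <= C * v k) ->
  exists2 C', 0 < C' & forall k, (0 < k)%N -> u k <= C' * v k.
Proof.
move=> u0 v0 C0 [N _ HN].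
exists (C + \sum_(1 <= j < N) u j / v j).
  rewrite ltr_wpDr// big_nat sumr_ge0// => j /andP[j0 _].
  by rewrite divr_ge0 ?u0// ltW// v0.
move=> k k0; have vk := v0 k k0.
have [Nk|kN] := leqP N k.
  apply: (le_trans (HN k Nk)); rewrite ler_pM2r// lerDl big_nat sumr_ge0// => j /andP[j0 _].
  by rewrite divr_ge0 ?u0// ltW// v0.
rewrite -ler_pdivrMr//.
apply: (@le_trans _ _ (\sum_(1 <= j < N) u j / v j)); last by rewrite lerDr ltW.
rewrite (bigD1_seq k) ?mem_index_iota ?k0 ?iota_uniq//= lerDl.
rewrite big_nat_cond sumr_ge0// => j /andP[/andP[j0 _] _].
by rewrite divr_ge0 ?u0// ltW// v0.
Qed.

Section slow_variation.

Lemma slowly_varyingM (f g : R -> R) : slowly_varying f -> slowly_varying g ->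
  slowly_varying (fun x => f x * g x).
Proof.
move=> sf sg c c0; rewrite -[X in _ --> X]mulr1.
have -> : (fun x => f (c * x) * g (c * x) / (f x * g x)) =
    (fun x => (f (c * x) / f x) * (g (c * x) / g x)).
  by apply/funext => x; rewrite invfM mulrACA.
by apply: cvgM; [exact: sf|exact: sg].
Qed.

Lemma slowly_varying_cst (C : R) : C != 0 -> slowly_varying (fun=> C).
Proof. by move=> C0 c c0; rewrite divff//; exact: cvg_cst. Qed.

(** [ln (1 + c x)] and [ln (1 + x)] differ by at most [`|ln c|]. *)
Lemma slowly_varying_1pln : slowly_varying (fun x : R => 1 + ln (1 + x)).
Proof.
move=> c c0; apply/cvgrPdist_le => e e0; near=> x.
have x0 : 0 < x by near: x; exact: near_pinfty_gt.
have x1 : 0 < 1 + x by rewrite addr_gt0.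
have cx1 : 0 < 1 + c * x by rewrite addr_gt0// mulr_gt0.
have l0 : 0 < 1 + ln (1 + x).
  by rewrite ltr_wpDr// ln_ge0// lerDl ltW.
have lbig : `|ln c| / e <= ln (1 + x).
  apply: (@le_trans _ _ (ln x)); last by rewrite ler_ln ?posrE// lerDr.
  by near: x; exact: near_ln_ge.
have -> : 1 - (1 + ln (1 + c * x)) / (1 + ln (1 + x)) =
   (ln (1 + x) - ln (1 + c * x)) / (1 + ln (1 + x)) by field; rewrite gt_eqF.
rewrite normrM [`|_^-1|]gtr0_norm ?invr_gt0// ler_pdivrMr//.
apply: (@le_trans _ _ `|ln c|); last first.
  by rewrite mulrC -ler_pdivrMr// (le_trans lbig)// lerDr.
have [c1|c1] := leP 1 c.
  have lc := ln_ge0 c1.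
  rewrite (ger0_norm lc) ler0_norm; last first.
    by rewrite subr_le0 ler_ln ?posrE// lerD2l ler_peMl// ltW.
  rewrite opprB lerBlDr -lnM ?posrE// ler_ln ?posrE ?mulr_gt0//.
  by rewrite mulrDr mulr1 lerD2r.
have lc : ln c <= 0 by rewrite ln_le0// ltW.
rewrite (ler0_norm lc) ger0_norm; last first.
  by rewrite subr_ge0 ler_ln ?posrE// lerD2l ler_piMl// ltW.
rewrite lerBlDl lerBrDr -lnM ?posrE// ler_ln ?posrE ?mulr_gt0//.
by rewrite mulrDl mul1r [x * c]mulrC lerD2r ltW.
Unshelve. all: by end_near. Qed.

(** The lower function is a multiple of [l]; the upper one also carries the
    logarithm of the number of slices. *)
Lemma regularly_varying_bounds (q : nat -> R) (c a : R) (l H : R -> R) :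
  0 < c <= 1 -> laplace_lower q c H -> laplace_upper q c H ->
  (forall z, 0 <= H z <= 1) ->
  (forall y z : R, 0 < y -> y <= z -> H z <= H y) ->
  slowly_varying l -> (forall x : R, 0 < x -> H x = l x * x `^ (- a)) ->
  (forall k, (0 < k)%N -> 0 < q k) ->
  exists L U : R -> R, [/\ positive_slowly_varying L, positive_slowly_varying U &
    forall k, (0 < k)%N ->
      L k%:R * k%:R `^ (- a) <= q k <= U k%:R * k%:R `^ (- a)].
Proof.
move=> c01 qlow qup H01 Hmon sl HE q0; have /andP[c0 _] := c01.
have H0 z : 0 < z -> 0 <= H z by case/andP: (H01 z).
have H1 z : H z <= 1 by case/andP: (H01 z).
have Hgt := regularly_varying_gt0 H0 Hmon sl HE.
have Hdbl := regularly_varying_doubling_ge H0 sl HE.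
have kap0 : 0 < 2^-1 * 2 `^ (- a) :> R by rewrite mulr_gt0 ?invr_gt0// powR_gt0.
have [C1 C10 up] := dominated_upper kap0 H1 Hmon Hgt Hdbl c0 qup.
have [C2 C20 low] := dominated_lower Hmon c01 qlow.
have lgt x : 0 < x -> 0 < l x.
  by move=> x0; have := Hgt _ x0; rewrite HE// pmulr_lgt0// powR_gt0.
have kp (k : nat) : (0 < k)%N -> 0 < (k%:R : R) `^ (- a).
  by move=> k0; rewrite powR_gt0// ltr0n.
have Hk (k : nat) : (0 < k)%N -> 0 < H k%:R by move=> k0; rewrite Hgt// ltr0n.
have lnp (x : R) : 0 < x -> 0 < 1 + ln (1 + x).
  by move=> x0; rewrite ltr_wpDr// ln_ge0// lerDl ltW.
have [U1 U10 HU] : exists2 C', 0 < C' & forall k, (0 < k)%N ->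
    q k <= C' * ((1 + ln (1 + k%:R)) * H k%:R).
  apply: (@near_to_all _ _ C1) => //.
  - by move=> k k0; rewrite ltW// q0.
  - by move=> k k0; rewrite mulr_gt0 ?Hk// lnp// ltr0n.
  near=> k; have k0 : (0 < k)%N by near: k; exists 1%N.
  have kR : 0 < k%:R :> R by rewrite ltr0n.
  apply: (@le_trans _ _ (C1 * (1 + ln k%:R) * H k%:R)); first by near: k.
  rewrite mulrA ler_pM2r ?Hk// ler_pM2l// lerD2l ler_ln ?posrE ?addr_gt0//.
  by rewrite lerDr.
have [L1 L10 HL] : exists2 C', 0 < C' & forall k, (0 < k)%N ->
    H k%:R <= C' * q k.
  apply: (@near_to_all _ _ C2^-1) => //.
  - by move=> k k0; rewrite ltW// Hk.
  - by rewrite invr_gt0.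
  by near=> k; rewrite ler_pdivlMl//; near: k.
exists (fun x => L1^-1 * l x), (fun x => U1 * ((1 + ln (1 + x)) * l x)); split.
- split; first by move=> x x0; rewrite mulr_gt0 ?invr_gt0 ?lgt.
  apply: slowly_varyingM => //; apply: slowly_varying_cst.
  by rewrite invr_eq0 gt_eqF.
- split; first by move=> x x0; rewrite !mulr_gt0 ?lgt ?lnp.
  apply: slowly_varyingM; first by apply: slowly_varying_cst; rewrite gt_eqF.
  by apply: slowly_varyingM => //; exact: slowly_varying_1pln.
- move=> k k0; have kR : 0 < k%:R :> R by rewrite ltr0n.
  apply/andP; split.
    by rewrite -mulrA -HE// ler_pdivrMl// HL.
  by rewrite -!mulrA -HE// HU.
Unshelve. all: by end_near. Qed.

End slow_variation.
End conclusions.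

(** * The in-degree distribution in each domain of attraction *)

Lemma asymp_equiv_near_eq (R : realType) (G1 G2 F : R -> R) :
  (\forall x \near +oo, G1 x = G2 x) -> asymp_equiv G1 F -> asymp_equiv G2 F.
Proof.
move=> G12; apply: cvg_trans; apply: near_eq_cvg; near=> x.
by have -> : G1 x = G2 x by near: x.
Unshelve. all: by end_near. Qed.

Section model.
Context (R : realType) (d : measure_display) (T : measurableType d).
Context (P : probability T R) (W : {RV P >-> R}) (m : nat).
Hypotheses (m_gt0 : (0 < m)%N) (W_ge0 : forall t : T, 0 <= W t)
  (W_gt0 : P [set t | 0 < W t] = 1%E) (W_mean : ('E_P[W] < +oo)%E).

Let e := mean_weight W / m%:R.

Lemma mean_weight_gt0 : 0 < mean_weight W.
Proof.
have E0 : (0 < 'E_P[W])%E.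
  by rewrite unlock; apply: ae_gt0_integral => //; exact: measurable_funP.
by rewrite /mean_weight fine_gt0// E0.
Qed.

Let e_gt0 : 0 < e.
Proof. by rewrite divr_gt0 ?mean_weight_gt0// ltr0n. Qed.

Let indeg_pos k : 0 < indeg_dist W m k.
Proof. exact: (indeg_gt0 W_ge0 (erefl e) e_gt0). Qed.

Lemma thetaE : theta W m = 1 + e. Proof. by []. Qed.

Section bounded_support.
Hypothesis sup1 : weight_sup W = 1%E.

(** A point between 1 and [x] with distribution function less than 1 would
    contradict the value of the supremum. *)
Lemma tail_gt_sup (x : R) : 1 < x -> tail W x = 0.
Proof.
move=> x1; pose y := (1 + x) / 2.
have y1 : 1 < y by rewrite /y; lra.
have yx : y < x by rewrite /y; lra.
have cy : cdf W y = 1%E.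
  apply/eqP; rewrite eq_le cdf_le1/= leNgt; apply/negP => cy1.
  have : (y%:E <= weight_sup W)%E.
    apply: ereal_sup_ubound; exists y => //; split => //.
    exact: lt_trans y1.
  by rewrite sup1 lee_fin leNgt y1.
have mle : measurable (W @^-1` `]-oo, y]).
  by rewrite -[_ @^-1` _]setTI; exact: measurable_funP.
apply/eqP; rewrite -eqe tailE eq_le measure_ge0 andbT.
have N0 : P (~` (W @^-1` `]-oo, y])) = 0%E.
  by rewrite probability_setC// -[P _]/(cdf W y) cy subee.
apply: (@le_trans _ _ (P (~` (W @^-1` `]-oo, y])))); last by rewrite N0.
rewrite le_measure ?inE//; [exact: measurable_le_W|exact: measurableC|].
by move=> t /= xt; rewrite in_itv/= => /le_lt_trans /(_ yx); rewrite ltNge xt.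
Qed.

Let measurable_gt_sup : measurable [set t | 1 < W t].
Proof. by apply: measurable_gt; exact: measurable_funP. Qed.

Lemma gt_sup_null : P [set t | 1 < W t] = 0%E.
Proof.
apply/eqP; rewrite eq_le measure_ge0 andbT.
apply: le_trans (tail_level W_ge0 (lexx 0)).
rewrite le_measure ?inE//; first exact: measurable_tail_level.
by move=> t /= /tail_gt_sup ->.
Qed.

(** On [W = 1] the extended inverse is [+oo], on [W < 1] the inequality can be
    inverted, and [W > 1] is negligible. *)
Lemma inv_gap_tailE (x : R) : 0 < x -> inv_gap_tail W x = tail W (1 - x^-1).
Proof.
move=> x0; rewrite /inv_gap_tail /tail; congr fine.
have -> : [set t | (x%:E <= ((1 - W t)%:E)^-1)%E] =
    [set t | 1 - x^-1 <= W t] `\` [set t | 1 < W t].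
  apply/seteqP; split => t /=.
    rewrite inver; case: ifPn => [/eqP|] W1.
      move=> _; have <- : 1 = W t by apply/eqP; rewrite -subr_eq0 W1.
      by rewrite ltxx lerBlDr lerDl invr_ge0 ltW.
    rewrite lee_fin => xW.
    have W0 : 0 < 1 - W t by rewrite -invr_gt0 (lt_le_trans x0).
    split; last by apply/negP; rewrite -leNgt -subr_ge0 ltW.
    by rewrite lerBlDr -lerBlDl -[leLHS]invrK lef_pV2 ?posrE ?invr_gt0.
  move=> [xW /negP]; rewrite -leNgt => W1.
  rewrite inver; case: ifPn => [_|W1']; first by rewrite leey.
  have W0 : 0 < 1 - W t by rewrite lt_neqAle eq_sym W1' subr_ge0.
  by rewrite lee_fin -[leLHS]invrK lef_pV2 ?posrE ?invr_gt0// lerBlDl -lerBlDr.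
rewrite measureD.
- rewrite [X in (_ - X)%E](_ : _ = 0%E) ?sube0//.
  apply/eqP; rewrite eq_le measure_ge0 andbT -gt_sup_null le_measure ?inE//.
  by apply: measurableI; [exact: measurable_le_W|].
- exact: measurable_le_W.
- by [].
- by rewrite (le_lt_trans (probability_le1 _ _)) ?ltry//; exact: measurable_le_W.
Qed.

Let q (k : nat) := indeg_dist W m k * (1 + e) ^+ k.
Let H (z : R) := tail W (1 - z^-1).
Let c := 1 - (1 + e)^-1.

Let c01 : 0 < c <= 1.
Proof.
have e1 : 0 < 1 + e by rewrite addr_gt0.
by rewrite /c subr_gt0 invf_lt1// ltrDl e_gt0/= gerBl invr_ge0 ltW.
Qed.

Let c0 : 0 < c. Proof. by case/andP: c01. Qed.

Let qE k : indeg_dist W m k = q k * theta W m ^- k.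
Proof. by rewrite /q thetaE mulfK// expf_neq0// gt_eqF// addr_gt0. Qed.

Let qlow : laplace_lower q c H :=
  laplace_lower_bounded W_ge0 (erefl e) e_gt0 tail_gt_sup.
Let qup : laplace_upper q c H :=
  laplace_upper_bounded W_ge0 (erefl e) e_gt0 tail_gt_sup.

Let asymp_H F : asymp_equiv (inv_gap_tail W) F -> asymp_equiv H F.
Proof.
apply: asymp_equiv_near_eq; near=> x; apply: inv_gap_tailE.
near: x; exact: near_pinfty_gt.
Unshelve. all: by end_near. Qed.

Lemma bounded_weibull (alpha : R) :
  (exists l : R -> R, slowly_varying l /\
    forall x : R, 0 < x -> tail W (1 - x^-1) = l x * x `^ (- (alpha - 1))) ->
  exists L U : R -> R,
    positive_slowly_varying L /\ positive_slowly_varying U /\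
    forall k : nat, m%:R / mean_weight W < k%:R ->
      L k%:R * k%:R `^ (- (alpha - 1)) * (theta W m) ^- k
        <= indeg_dist W m k
        <= U k%:R * k%:R `^ (- (alpha - 1)) * (theta W m) ^- k.
Proof.
move=> [l [sl HE]].
have th0 : 0 < theta W m by rewrite thetaE addr_gt0.
have H01 z : 0 <= H z <= 1 by rewrite tail_ge0 tail_le1.
have Hmon y z : 0 < y -> y <= z -> H z <= H y.
  move=> y0 yz; apply: tail_nonincreasing.
  by rewrite lerD2l lerN2 lef_pV2 ?posrE// (lt_le_trans y0).
have q0 k : (0 < k)%N -> 0 < q k.
  by move=> _; rewrite mulr_gt0// exprn_gt0.
have [L [U [sL sU LU]]] := regularly_varying_bounds c01 qlow qup H01 Hmon sl HE q0.
exists L, U; split => //; split => // k mk.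
have k0 : (0 < k)%N.
  by rewrite -(ltr0n R) (lt_trans _ mk)// divr_gt0 ?mean_weight_gt0// ltr0n.
have ip : 0 < theta W m ^- k by rewrite invr_gt0 exprn_gt0.
by rewrite qE !(ler_pM2r ip); exact: LU.
Qed.

Lemma bounded_gumbel_stretched (a c1 tau b : R) : 0 < a -> 0 < c1 -> 0 < tau ->
  asymp_equiv (inv_gap_tail W)
    (fun x => a * x `^ b * expR (- (x / c1) `^ tau)) ->
  let gamma := 1 / (tau + 1) in
  with_o1 (indeg_dist W m) (fun k o =>
    expR (- ((1 + o) * (tau `^ gamma / (1 - gamma))
             * ((1 - (theta W m)^-1) * k%:R / c1) `^ (1 - gamma)))
    * (theta W m) ^- k).
Proof.
move=> a0 c10 tau0 /asymp_H GE gamma.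
have [eps [eps0 E]] := stretched_asymp c10 tau0 c0 qlow qup
  (stretched_tail_le a0 c10 tau0 GE) (stretched_tail_ge a0 c10 tau0 GE).
exists eps; split => //; near=> k; rewrite qE.
rewrite -mulrA; congr (_ * _); near: k; exact: E.
Unshelve. all: by end_near. Qed.

Lemma bounded_gumbel_log (a c1 b tau : R) : 0 < a -> 0 < c1 -> 1 < tau ->
  asymp_equiv (inv_gap_tail W)
    (fun x => a * (ln x) `^ b * expR (- (ln x / c1) `^ tau)) ->
  let K := tau * ln (expR 1 * c1 `^ tau * (1 - (theta W m)^-1) / tau) in
  with_o1 (indeg_dist W m) (fun k o =>
    expR (- ((ln k%:R / c1) `^ tau
             * (1 - tau * (tau - 1) * (ln (ln k%:R) / ln k%:R)
                + (K + o) / ln k%:R)))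
    * (theta W m) ^- k).
Proof.
move=> a0 c10 tau1 /asymp_H GE K.
have qlow1 : laplace_lower q (c * 1) H by rewrite mulr1.
have qup1 : laplace_upper q (c * 1) H by rewrite mulr1.
have [eps [eps0 E]] := log_stretched_asymp c10 tau1 c0 ltr01 qlow1 qup1
  (log_tail_le a0 c10 tau1 GE) (log_tail_ge a0 c10 tau1 GE).
exists eps; split => //; near=> k; rewrite qE; congr (_ * _).
rewrite -[k%:R]mul1r; near: k; exact: E.
Unshelve. all: by end_near. Qed.

(** The normalised kernel [theta ^+ k * kern e k x] is at most
    [exp (- c k (1 - x))] for [x <= 1], hence bounded by 1 and convergent to 0
    for [x < 1], and it is constantly [e / (1 + e) = 1 - theta^-1] at
    [x = 1]. *)
Lemma bounded_atom : let q0 := fine (P [set t | W t = 1]) in 0 < q0 ->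
  with_o1 (indeg_dist W m) (fun k o =>
    q0 * (1 - (theta W m)^-1) * (theta W m) ^- k * (1 + o)).
Proof.
move=> q0 q0_gt0.
have e1 : 0 < 1 + e by rewrite addr_gt0.
pose A := [set t | W t = 1].
have mA : measurable A.
  have -> : A = setT `&` W @^-1` [set 1] by rewrite setTI.
  exact: measurable_funP.
pose f_ (k : nat) (t : T) : \bar R := (kern e k (W t) * (1 + e) ^+ k)%:E.
pose f (t : T) : \bar R := (c * \1_A t)%:E.
have th k : 0 < (1 + e) ^+ k by rewrite exprn_gt0.
have kc : e / (1 + e) = c by rewrite /c; field; rewrite gt_eqF.
have ae1 (Q : T -> Prop) : (forall t, W t <= 1 -> Q t) -> {ae P, forall t, Q t}.
  move=> HQ; exists [set t | 1 < W t]; split.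
  - exact: measurable_gt_sup.
  - exact: gt_sup_null.
  - by move=> t /=; apply: contra_notP => /negP; rewrite -leNgt; exact: HQ.
have mf_ k : measurable_fun setT (f_ k).
  apply/measurable_EFinP; apply: measurable_funM => //.
  exact: measurable_kern.
have mf : measurable_fun setT f.
  by apply/measurable_EFinP; apply: measurable_funM => //; exact: measurable_indic.
have kle k t : W t <= 1 ->
    kern e k (W t) * (1 + e) ^+ k <= expR (- (c * k%:R * (1 - W t))).
  by move=> W1; apply: kern_theta_le => //; rewrite W_ge0.
have cvg1 : {ae P, forall t, setT t -> f_ ^~ t @ \oo --> f t}.
  apply: ae1 => t W1 _; apply/cvg_EFin; first by near=> k.
  move: W1; rewrite le_eqVlt => /predU1P[W1|W1].
    have -> : c * \1_A t = c by rewrite indicE mem_set// mulr1.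
    apply: cvg_near_cst; near=> k => /=.
    by rewrite kern_mul_expn W1 mul1r [e + 1]addrC divff ?gt_eqF// expr1n mulr1.
  have -> : c * \1_A t = 0.
    by rewrite indicE memNset ?mulr0// => W1'; rewrite W1' ltxx in W1.
  apply: (@squeeze_cvgr _ _ _ _ (fun=> 0) (fun k : nat => expR (- (c * (1 - W t) * k%:R)))).
  - near=> k; rewrite /= mulr_ge0 ?(ltW (th k)) ?kern_ge0//=.
    by rewrite [c * _ * _]mulrAC; apply: kle; exact: ltW.
  - exact: cvg_cst.
  - have cW : 0 < c * (1 - W t) by rewrite mulr_gt0// subr_gt0.
    have := cvg_mul_natr_pinfty cW.
    move=> h; exact: (@cvg_comp _ _ _ (fun k : nat => c * (1 - W t) * k%:R)
      (fun x : R => expR (- x)) _ _ _ h (@cvgr_expR R)).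
have dom : {ae P, forall t, forall k, setT t -> (`|f_ k t| <= cst 1%E t)%E}.
  apply: ae1 => t W1 k _; rewrite /f_ gee0_abs; last first.
    by rewrite lee_fin mulr_ge0 ?(ltW (th k)) ?kern_ge0.
  rewrite lee_fin (le_trans (kle k t W1))// expR_le1 oppr_le0.
  by rewrite mulr_ge0 ?subr_ge0// mulr_ge0 ?(ltW c0).
have int1 : P.-integrable setT (cst 1%E : T -> \bar R).
  exact: (finite_measure_integrable_cst P 1).
have [_ _] := dominated_convergence measurableT mf_ mf cvg1 int1 dom.
have fkE k : (\int[P]_t f_ k t)%E = (q k)%:E.
  rewrite /f_ /q EFinM (indeg_fineK W_ge0 (erefl e) e_gt0).
  under eq_integral do rewrite EFinM.
  rewrite ge0_integralZr//.
  - by apply/measurable_EFinP; exact: measurable_kern.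
  - by move=> t _; rewrite lee_fin kern_ge0.
  - by rewrite lee_fin ltW.
have fE : (\int[P]_t f t)%E = (c * q0)%:E.
  rewrite /f; under eq_integral do rewrite EFinM.
  rewrite ge0_integralZl//; last 2 first.
  - by apply/measurable_EFinP; exact: measurable_indic.
  - by rewrite lee_fin ltW.
  rewrite integral_indic// setIT EFinM; congr (_ * _)%E.
  by rewrite /q0 fineK// fin_num_measure.
rewrite fE; under eq_fun do rewrite fkE.
move=> /fine_cvgP[_ /= qcvg].
have cq0 : 0 < c * q0 by rewrite mulr_gt0.
exists (fun k => q k / (c * q0) - 1); split.
  rewrite -(subrr 1); apply: cvgB; last exact: cvg_cst.
  rewrite -(@divff _ (c * q0)) ?gt_eqF//.
  by apply: cvgMl; exact: qcvg.
near=> k; rewrite qE (_ : 1 - (theta W m)^-1 = c)// [1 + _]addrC subrK.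
by field; rewrite !gt_eqF// exprn_gt0.
Unshelve. all: by end_near. Qed.

End bounded_support.

Section unit_mean.
Hypothesis mean1 : ('E_P[W] = 1)%E.

Let q (k : nat) := k%:R * indeg_dist W m k.
Let mR : 0 < m%:R :> R. Proof. by rewrite ltr0n. Qed.

Let eE : e = m%:R^-1.
Proof. by rewrite /e /mean_weight mean1 mul1r. Qed.

Let e01 : 0 < e <= 1.
Proof. by rewrite e_gt0 eE invf_le1// ler1n. Qed.

Let qup : laplace_upper q e (tail W) :=
  laplace_upper_unbounded W_ge0 (erefl e) e_gt0.

Let qlow rho : rho < 1 -> (\forall z \near +oo, tail W (2 * z) <= rho * tail W z) ->
  laplace_lower q e (tail W) :=
  fun r1 h => laplace_lower_unbounded W_ge0 (erefl e) e_gt0 r1 h.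

Let half1 : 2^-1 < 1 :> R. Proof. by rewrite invf_lt1// ltr1n. Qed.

Let qE k : (0 < k)%N -> indeg_dist W m k = k%:R^-1 * q k.
Proof. by move=> k0; rewrite /q mulKf// pnatr_eq0 -lt0n. Qed.

(** The factor [k^-1] between [p(k)] and [q k] adds [ln k] to the exponent,
    which is negligible against the rate and goes into the error. *)
Lemma unbounded_gumbel_stretched (a c1 tau b : R) : 0 < a -> 0 < c1 -> 0 < tau ->
  asymp_equiv (tail W)
    (fun x => a * x `^ b * expR (- (x / c1) `^ tau)) ->
  let gamma := 1 / (tau + 1) in
  with_o1 (indeg_dist W m) (fun k o =>
    expR (- (tau `^ gamma / (1 - gamma)
             * (k%:R / (c1 * m%:R)) `^ (1 - gamma) * (1 + o)))).
Proof.
move=> a0 c10 tau0 GE gamma.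
have low := qlow half1 (stretched_tail_doubling a0 c10 tau0 GE).
have [eps [eps0 E]] := stretched_asymp c10 tau0 e_gt0 low qup
  (stretched_tail_le a0 c10 tau0 GE) (stretched_tail_ge a0 c10 tau0 GE).
pose A (k : nat) := stretched_rate c1 tau (e * k%:R).
have A1 := @near_rate_ln R c1 tau c10 tau0 e 1 0 1 e_gt0 ltr01.
have Agt0 : \forall k \near \oo, 0 < A k.
  near=> k; have : 1 + 0 * ln k%:R <= 1 * A k by near: k.
  by rewrite mul0r addr0 mul1r; exact: lt_le_trans.
exists (fun k => eps k + ln k%:R / A k); split.
  rewrite -(addr0 0); apply: cvgD => //.
  apply/cvgrPdist_le => r r0.
  have Ar := @near_rate_ln R c1 tau c10 tau0 e 0 1 r e_gt0 r0.
  near=> k; have Ak : 0 < A k by near: k.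
  have k1 : 1 <= k%:R :> R by rewrite ler1n; near: k; exists 1%N.
  rewrite sub0r normrN ger0_norm; last by rewrite divr_ge0 ?ln_ge0// ltW.
  rewrite ler_pdivrMr//.
  have : 0 + 1 * ln k%:R <= r * A k by near: k.
  by rewrite add0r mul1r.
near=> k.
have k0 : (0 < k)%N by near: k; exists 1%N.
have kR : 0 < k%:R :> R by rewrite ltr0n.
have Ak : 0 < A k by near: k.
rewrite qE// (_ : q k = expR (- ((1 + eps k) * A k))); last by near: k; exact: E.
rewrite -[k%:R^-1]lnK ?posrE ?invr_gt0// -expRD lnV ?posrE//; congr expR.
rewrite (_ : k%:R / (c1 * m%:R) = e * k%:R / c1); last first.
  by rewrite eE; field; rewrite !gt_eqF.
rewrite -[_ * (e * k%:R / c1) `^ _]/(A k); field; rewrite gt_eqF//.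
Unshelve. all: by end_near. Qed.

(** Here [e * k = k / m] is the variable of the expansion, so the constant [c]
    of [log_stretched_asymp] is 1, which removes it from [K]. *)
Lemma unbounded_gumbel_log (a c1 b tau : R) : 0 < a -> 0 < c1 -> 1 < tau ->
  asymp_equiv (tail W)
    (fun x => a * (ln x) `^ b * expR (- (ln x / c1) `^ tau)) ->
  let K := tau * ln (expR 1 * c1 `^ tau / tau) in
  with_o1 (indeg_dist W m) (fun k o =>
    k%:R^-1 * expR (- ((ln (k%:R / m%:R) / c1) `^ tau
      * (1 - tau * (tau - 1)
             * (ln (ln (k%:R / m%:R)) / ln (k%:R / m%:R))
         + (K + o) / ln (k%:R / m%:R))))).
Proof.
move=> a0 c10 tau1 GE K.
have low := qlow half1 (log_tail_doubling a0 c10 tau1 GE).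
have mi0 : 0 < m%:R^-1 :> R by rewrite invr_gt0.
have low1 : laplace_lower q (1 * m%:R^-1) (tail W) by rewrite mul1r -eE.
have up1 : laplace_upper q (1 * m%:R^-1) (tail W) by rewrite mul1r -eE.
have [eps [eps0 E]] := log_stretched_asymp c10 tau1 ltr01 mi0 low1 up1
  (log_tail_le a0 c10 tau1 GE) (log_tail_ge a0 c10 tau1 GE).
exists eps; split => //; near=> k.
have k0 : (0 < k)%N by near: k; exists 1%N.
rewrite qE//; congr (_ * _).
rewrite /K -[_ * c1 `^ tau]mulr1 [k%:R / _]mulrC; near: k; exact: E.
Unshelve. all: by end_near. Qed.

(** The factor [k^-1] between [p(k)] and [q k] turns the exponent [alpha - 1]
    of the tail into [alpha]. *)
Lemma unbounded_frechet (alpha : R) (l : R -> R) : 1 < alpha ->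
  slowly_varying l ->
  (forall x : R, 0 < x -> tail W x = l x * x `^ (- (alpha - 1))) ->
  exists L U : R -> R,
    positive_slowly_varying L /\ positive_slowly_varying U /\
    forall k : nat, (0 < k)%N ->
      L k%:R * k%:R `^ (- alpha) <= indeg_dist W m k
        <= U k%:R * k%:R `^ (- alpha).
Proof.
move=> alpha1 sl GE.
have a1 : 0 < alpha - 1 by rewrite subr_gt0.
have G01 z : 0 <= tail W z <= 1 by rewrite tail_ge0 tail_le1.
have Gmon y z : 0 < y -> y <= z -> tail W z <= tail W y.
  by move=> _; exact: tail_nonincreasing.
have G0 z : 0 < z -> 0 <= tail W z by move=> _; exact: tail_ge0.
have [rho rho1 dbl] := regularly_varying_doubling_le G0 sl GE a1.
have q0 k : (0 < k)%N -> 0 < q k by move=> k0; rewrite mulr_gt0// ltr0n.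
have [L [U [sL sU LU]]] :=
  regularly_varying_bounds e01 (qlow rho1 dbl) qup G01 Gmon sl GE q0.
exists L, U; split => //; split => // k k0.
have kR : 0 < k%:R :> R by rewrite ltr0n.
have kE : k%:R `^ (- alpha) = k%:R^-1 * k%:R `^ (- (alpha - 1)) :> R.
  rewrite -powR_inv1 ?(ltW kR)// -powRD_gt0//; congr (_ `^ _); ring.
rewrite qE// kE !(mulrCA _ k%:R^-1) !ler_pM2l ?invr_gt0//.
exact: LU.
Qed.

End unit_mean.
End model.

Theorem theorem2p7 (R : realType) (d : measure_display) (T : measurableType d)
    (P : probability T R) (W : {RV P >-> R}) (m : nat)
    (m_gt0 : (0 < m)%N)
    (W_ge0 : forall t : T, 0 <= W t)
    (W_gt0 : P [set t | 0 < W t] = 1%E)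
    (W_mean : ('E_P[W] < +oo)%E) :
  (* Bounded *)
  (weight_sup W = 1%E ->
    (* (a) *)
    (forall alpha : R, 1 < alpha ->
      (exists l : R -> R, slowly_varying l /\
        forall x : R, 0 < x -> tail W (1 - x^-1) = l x * x `^ (- (alpha - 1))) ->
      exists L U : R -> R,
        positive_slowly_varying L /\ positive_slowly_varying U /\
        forall k : nat, m%:R / mean_weight W < k%:R ->
          L k%:R * k%:R `^ (- (alpha - 1)) * (theta W m) ^- k
            <= indeg_dist W m k
            <= U k%:R * k%:R `^ (- (alpha - 1)) * (theta W m) ^- k)
    /\
    (* (b)(i) *)
    (forall a c1 tau b : R, 0 < a -> 0 < c1 -> 0 < tau ->
      asymp_equiv (inv_gap_tail W)
        (fun x => a * x `^ b * expR (- (x / c1) `^ tau)) ->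
      let gamma := 1 / (tau + 1) in
      with_o1 (indeg_dist W m) (fun k o =>
        expR (- ((1 + o) * (tau `^ gamma / (1 - gamma))
                 * ((1 - (theta W m)^-1) * k%:R / c1) `^ (1 - gamma)))
        * (theta W m) ^- k))
    /\
    (* (b)(ii) *)
    (forall a c1 b tau : R, 0 < a -> 0 < c1 -> 1 < tau ->
      asymp_equiv (inv_gap_tail W)
        (fun x => a * (ln x) `^ b * expR (- (ln x / c1) `^ tau)) ->
      let K := tau * ln (expR 1 * c1 `^ tau * (1 - (theta W m)^-1) / tau) in
      with_o1 (indeg_dist W m) (fun k o =>
        expR (- ((ln k%:R / c1) `^ tau
                 * (1 - tau * (tau - 1) * (ln (ln k%:R) / ln k%:R)
                    + (K + o) / ln k%:R)))
        * (theta W m) ^- k))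
    /\
    (* (c) *)
    (let q0 := fine (P [set t | W t = 1]) in
      0 < q0 ->
      with_o1 (indeg_dist W m) (fun k o =>
        q0 * (1 - (theta W m)^-1) * (theta W m) ^- k * (1 + o))))
  /\
  (* Gumbel *)
  (('E_P[W] = 1)%E ->
    (* (i) *)
    (forall a c1 tau b : R, 0 < a -> 0 < c1 -> 0 < tau ->
      asymp_equiv (tail W)
        (fun x => a * x `^ b * expR (- (x / c1) `^ tau)) ->
      let gamma := 1 / (tau + 1) in
      with_o1 (indeg_dist W m) (fun k o =>
        expR (- (tau `^ gamma / (1 - gamma)
                 * (k%:R / (c1 * m%:R)) `^ (1 - gamma) * (1 + o)))))
    /\
    (* (ii) *)
    (forall a c1 b tau : R, 0 < a -> 0 < c1 -> 1 < tau ->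
      asymp_equiv (tail W)
        (fun x => a * (ln x) `^ b * expR (- (ln x / c1) `^ tau)) ->
      let K := tau * ln (expR 1 * c1 `^ tau / tau) in
      with_o1 (indeg_dist W m) (fun k o =>
        k%:R^-1 * expR (- ((ln (k%:R / m%:R) / c1) `^ tau
          * (1 - tau * (tau - 1)
                 * (ln (ln (k%:R / m%:R)) / ln (k%:R / m%:R))
             + (K + o) / ln (k%:R / m%:R)))))))
  /\
  (* Frechet *)
  (('E_P[W] = 1)%E ->
    forall (alpha : R) (l : R -> R), 2 < alpha ->
      (forall x : R, 0 < x -> 0 <= l x) -> slowly_varying l ->
      (forall x : R, 0 < x -> tail W x = l x * x `^ (- (alpha - 1))) ->
      exists L U : R -> R,
        positive_slowly_varying L /\ positive_slowly_varying U /\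
        forall k : nat, (0 < k)%N ->
          L k%:R * k%:R `^ (- alpha) <= indeg_dist W m k
            <= U k%:R * k%:R `^ (- alpha)).
Proof.
split; [move=> sup1; do !split|split; [move=> mean1; split|]].
- move=> alpha _; exact: bounded_weibull.
- move=> a c1 tau b; exact: bounded_gumbel_stretched.
- move=> a c1 b tau; exact: bounded_gumbel_log.
- exact: bounded_atom.
- move=> a c1 tau b; exact: unbounded_gumbel_stretched.
- move=> a c1 b tau; exact: unbounded_gumbel_log.
- move=> mean1 alpha l alpha2 _ sl tE.
  have alpha1 : 1 < alpha by apply: lt_trans alpha2; rewrite ltr1n.
  exact: (unbounded_frechet m_gt0 W_ge0 W_gt0 W_mean mean1 alpha1 sl tE).
Qed.
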